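(* Let $w$ be the blow-up solution of the De Gregorio equation on $[-T,0)$ obtained by the construction described in the context (blow-up time $t=0$). Then $w$ is not asymptotically self-similar in the sense defined in the context.
   Context: **Equation.** $Hf(x)=\frac1\pi\,\mathrm{p.v.}\int_{\mathbb{R}}\frac{f(y)}{x-y}dy$ is the Hilbert transform. The De Gregorio equation is $\partial_tw+u\,\partial_xw=w\,Hw$, $\partial_xu=Hw$, $u(0,t)=0$. **Construction.** Fix $0<r\le 1/4$. Let $\rho\ge0$ be a smooth bump function supported in $[1-r,1+r]$, symmetric with respect to $1$, with $H\rho(0)=-1/2$, and put $\phi(x)=\rho(-x)-\rho(x)$, so $\phi$ is odd and $H\phi(0)=1$. Let $c(r)=\frac{\sqrt{32r^3/3}}{\pi(1-2r)}$. Fix $\varepsilon>0$ sufficiently small and then $A>1$ sufficiently close to $1$ (depending on $r,\varepsilon,\phi$); let $a>0$ be the positive root of $a=A(1-e^{-a})$ and $T=a/(1-c(r)\varepsilon)$. For $n\ge0$ let $w_n$ (with velocity $u_n$) be the smooth solution of the De Gregorio equation on $[-T,0]$ with $w_n(x,0)=\sum_{k=0}^nA^k\phi(x/r^k)$. Write $w_n=\sum_{k=0}^nw_{n,k}$, where $\partial_tw_{n,k}+u_n\partial_xw_{n,k}=w_{n,k}Hw_n$ and $w_{n,k}(x,0)=A^k\phi(x/r^k)$. Let $x_{n,k}$ solve $x_{n,k}(0)=A^k$, $\dot x_{n,k}(t)=x_{n,k}(t)\sum_{j=0}^{k-1}Hw_{n,j}(0,t)$, and let $W_{n,k}(x,t)=w_{n,k}\big(x(r/A)^kx_{n,k}(t),t\big)/x_{n,k}(t)$.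 The parameters are chosen so that for all $n$, $0\le k\le n$, $t\in[-T,0]$: (B1) $W_{n,k}(x,t)=0$ unless $|x|\in[1-2r,1+2r]$; (B2) $\|\partial_x(W_{n,k}(\cdot,t)-\phi)\|_{L^2}\le\varepsilon$. The solution $w$ is a limit of a subsequence of $(w_n)$ as $n\to\infty$, the convergence being in $L^2$ and in $C^\infty$ on compact sets not containing $0$. **Asymptotic self-similarity.** $w$ is asymptotically self-similar if there are a profile $W\not\equiv0$ in some weighted $H^1$ space on $\mathbb{R}$, constants $c_l\in\mathbb{R}$, $c_w<0$, with \[ (c_lx+U)\,W_x=(c_w+U_x)\,W,\qquad U_x=HW,\quad U(0)=0, \] and scaling factors $C_w(t),C_l(t)>0$ such that $C_w(t)\,w(C_l(t)x,t)\to W(x)$ in some weighted $L^2$ norm as $t\to0^-$. It is moreover required that $C_l$ is continuous, and that if $c_l<0$ then $C_l(t)\to\infty$ as $t\to0^-$. Weights are positive measurable functions bounded below by a positive constant on each compact set, so that weighted $L^2$ (resp. $H^1$) implies $L^2_{loc}$ (resp. $H^1_{loc}$). *)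

(* Defs.v *)
From HB Require Import structures.
From mathcomp Require Import all_boot all_order all_algebra.
From mathcomp Require Import all_classical all_reals all_analysis.

Set Implicit Arguments.
Unset Strict Implicit.
Unset Printing Implicit Defensive.

Import Order.TTheory GRing.Theory Num.Theory.
Import numFieldNormedType.Exports.

Local Open Scope classical_set_scope.
Local Open Scope ring_scope.

(* Functions of space and time are written [f x t]. *)

(** * Hilbert transform *)

Definition hilbert_domain {R : realType} (x d : R) : set R :=
  [set y | d < `|x - y| < d^-1].

Definition hilbert_trunc {R : realType} (f : R -> R) (x d : R) : R :=
  \int[lebesgue_measure]_(y in hilbert_domain x d) (f y / (x - y)).

(* The principal value is taken both at the singularity and at infinity.
   [hilbert] is total; it is meaningful at [x] when [hilbert_exists f x]. *)
Definition hilbert_exists {R : realType} (f : R -> R) (x : R) : Prop :=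
  (forall d : R, 0 < d -> lebesgue_measure.-integrable (hilbert_domain x d)
                            (fun y => (f y / (x - y))%:E)) /\
  cvg (hilbert_trunc f x d @[d --> 0^'+]).

Definition hilbert {R : realType} (f : R -> R) (x : R) : R :=
  pi^-1 * lim (hilbert_trunc f x d @[d --> 0^'+]).

(** * Smoothness *)

Definition smooth {R : realType} (f : R -> R) : Prop :=
  forall (n : nat) (x : R), derivable (derive1n n f) x 1.

(* Derivative at [t] relative to a time set [J], hence one-sided at an
   endpoint of an interval [J]. *)
Definition dquot {R : realType} (f : R -> R) (t s : R) : R :=
  (f s - f t) / (s - t).

Definition has_deriv_within {R : realType} (J : set R) (f : R -> R) (t l : R) :
    Prop :=
  dquot f t @ within J (t^') --> l.

Definition deriv_within {R : realType} (J : set R) (f : R -> R) (t : R) : R :=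
  lim (dquot f t @ within J (t^')).

Definition dx {R : realType} (f : R -> R -> R) : R -> R -> R :=
  fun x t => derive1 (f ^~ t) x.

Definition dt {R : realType} (J : set R) (f : R -> R -> R) : R -> R -> R :=
  fun x t => deriv_within J (f x) t.

Definition partial {R : realType} (J : set R) (i j : nat) (f : R -> R -> R) :
    R -> R -> R :=
  iter i (dt J) (iter j dx f).

(* Smoothness on [E `*` J], up to the endpoints of [J] that belong to [J];
   [E] is meant to be open and [J] an interval. *)
Definition smooth_on {R : realType} (E J : set R) (f : R -> R -> R) : Prop :=
  forall i j : nat,
    (forall x t, E x -> J t -> derivable (partial J i j f ^~ t) x 1) /\
    (forall x t, E x -> J t ->
       has_deriv_within J (partial J i j f x) t (partial J i.+1 j f x t)) /\
    {within E `*` J, continuous (fun p : R * R => partial J i j f p.1 p.2)}.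

(** * The De Gregorio equation *)

Definition velocity {R : realType} (J : set R) (w u : R -> R -> R) : Prop :=
  forall t, J t ->
    u 0 t = 0 /\
    forall x, hilbert_exists (w ^~ t) x /\
              is_derive x 1 (u ^~ t) (hilbert (w ^~ t) x).

Definition transported {R : realType} (J : set R) (w u v : R -> R -> R) :
    Prop :=
  forall x t, J t ->
    dt J v x t + u x t * dx v x t = v x t * hilbert (w ^~ t) x.

Definition de_gregorio {R : realType} (J : set R) (w u : R -> R -> R) : Prop :=
  velocity J w u /\ transported J w u w.

(** * The construction *)

Definition L2norm {R : realType} (f : R -> R) : \bar R :=
  ('N[lebesgue_measure]_2%:E[EFin \o f])%E.

Definition admissible_bump {R : realType} (r : R) (rho : R -> R) : Prop :=
  [/\ smooth rho,
      (forall x, 0 <= rho x),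
      (forall x, rho x != 0 -> 1 - r <= x <= 1 + r),
      (forall x, rho (1 + x) = rho (1 - x)) &
      hilbert rho 0 = - 2^-1].

Definition odd_bump {R : realType} (rho : R -> R) (x : R) : R :=
  rho (- x) - rho x.

Definition c_const {R : realType} (r : R) : R :=
  Num.sqrt (32 * r ^+ 3 / 3) / (pi * (1 - 2 * r)).

(* [W_{n,k}], from [v = w_{n,k}] and [X = x_{n,k}]. *)
Definition rescaled {R : realType} (r A : R) (k : nat) (X : R -> R)
    (v : R -> R -> R) (x t : R) : R :=
  v (x * (r / A) ^+ k * X t) t / X t.

Record approx_solution {R : realType} (r : R) (phi : R -> R) (eps A T : R)
    (n : nat) (w u : R -> R -> R) (wk : nat -> R -> R -> R)
    (xk : nat -> R -> R) : Prop := ApproxSolution {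
  approx_smooth : smooth_on setT `[- T, 0] w;
  approx_eq : de_gregorio `[- T, 0] w u;
  approx_final : forall x, w x 0 = \sum_(k < n.+1) A ^+ k * phi (x / r ^+ k);
  approx_sum : forall x t : R, t \in `[- T, 0] ->
    w x t = \sum_(k < n.+1) wk k x t;
  approx_smooth_k : forall k, (k <= n)%N -> smooth_on setT `[- T, 0] (wk k);
  approx_eq_k : forall k, (k <= n)%N -> transported `[- T, 0] w u (wk k);
  approx_final_k : forall (k : nat) (x : R), (k <= n)%N ->
    wk k x 0 = A ^+ k * phi (x / r ^+ k);
  approx_scale_final : forall k, (k <= n)%N -> xk k 0 = A ^+ k;
  approx_scale_eq : forall (k : nat) (t : R), (k <= n)%N -> t \in `[- T, 0] ->
    has_deriv_within `[- T, 0] (xk k) t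
      (xk k t * \sum_(j < k) hilbert (wk j ^~ t) 0);
  approx_supp : forall (k : nat) (x t : R), (k <= n)%N -> t \in `[- T, 0] ->
    ~~ (1 - 2 * r <= `|x| <= 1 + 2 * r) ->
    rescaled r A k (xk k) (wk k) x t = 0;
  approx_H1 : forall (k : nat) (t : R), (k <= n)%N -> t \in `[- T, 0] ->
    (L2norm (derive1 (fun x : R => rescaled r A k (xk k) (wk k) x t - phi x)%R)
     <= eps%:E)%E
}.

(* Convergence in [L^2] at each time, and in [C^oo] on the compact subsets of
   [(R \ {0}) x [-T, 0)]. *)
Definition converges_to {R : realType} (T : R) (v : nat -> R -> R -> R)
    (w : R -> R -> R) : Prop :=
  [/\ smooth_on [set x | x != 0] `[- T, 0[ w,
      (forall t : R, t \in `[- T, 0[ ->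
         L2norm (fun x => v m x t - w x t) @[m --> \oo] --> 0%E) &
      (forall (i j : nat) (K : set R) (s e : R),
         compact K -> ~ K 0 -> s < 0 -> 0 < e ->
         \forall m \near \oo, forall x t : R, K x -> t \in `[- T, s] ->
           `|partial `[- T, 0[ i j (v m) x t - partial `[- T, 0[ i j w x t|
             <= e)].

Definition constructed_solution {R : realType} (r : R) (phi : R -> R)
    (eps A T : R) (w : R -> R -> R) : Prop :=
  exists (wn un : nat -> R -> R -> R) (wnk : nat -> nat -> R -> R -> R)
         (xnk : nat -> nat -> R -> R) (sigma : nat -> nat),
    [/\ (forall n,
           approx_solution r phi eps A T n (wn n) (un n) (wnk n) (xnk n)),
        (forall m m', (m < m')%N -> (sigma m < sigma m')%N) &
        converges_to T (fun m => wn (sigma m)) w].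

(** * Asymptotic self-similarity *)

Definition weight {R : realType} (om : R -> R) : Prop :=
  [/\ measurable_fun setT om,
      (forall x, 0 < om x) &
      (forall K : set R, compact K ->
         exists2 c : R, 0 < c & forall x, K x -> c <= om x)].

Definition weighted_L2sq {R : realType} (om f : R -> R) : \bar R :=
  (\int[lebesgue_measure]_x (om x * f x ^+ 2)%R%:E)%E.

Definition in_weighted_L2 {R : realType} (om f : R -> R) : Prop :=
  measurable_fun setT f /\ (weighted_L2sq om f < +oo)%E.

Definition test_function {R : realType} (psi : R -> R) : Prop :=
  smooth psi /\ exists M : R, forall x, M < `|x| -> psi x = 0.

Definition weak_derivative {R : realType} (f g : R -> R) : Prop :=
  [/\ locally_integrable setT f, locally_integrable setT g &
      forall psi : R -> R, test_function psi ->
        \int[lebesgue_measure]_x (f x * derive1 psi x) =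
        - \int[lebesgue_measure]_x (g x * psi x)].

(* [V] is the weak derivative of [W]; it is passed along since it also occurs
   in the profile equation. *)
Definition in_weighted_H1 {R : realType} (om W V : R -> R) : Prop :=
  [/\ in_weighted_L2 om W, in_weighted_L2 om V & weak_derivative W V].

Definition profile {R : realType} (c_l c_w : R) (W : R -> R) : Prop :=
  exists (om V U : R -> R),
    [/\ weight om /\ in_weighted_H1 om W V,
        ~ {ae lebesgue_measure, forall x, W x = 0},
        {ae lebesgue_measure, forall x, hilbert_exists W x},
        [/\ continuous U, U 0 = 0 & weak_derivative U (hilbert W)] &
        {ae lebesgue_measure, forall x,
           (c_l * x + U x) * V x = (c_w + hilbert W x) * W x}].

Definition asymptotically_self_similar {R : realType} (T : R)
    (w : R -> R -> R) : Prop :=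
  exists (W : R -> R) (c_l c_w : R) (C_w C_l om : R -> R),
    [/\ c_w < 0 /\ profile c_l c_w W,
        (forall t : R, t \in `[- T, 0[ -> 0 < C_w t /\ 0 < C_l t),
        {within `[- T, 0[, continuous C_l},
        (c_l < 0 -> C_l t @[t --> 0^'-] --> +oo) &
        weight om /\
        weighted_L2sq om (fun x => C_w t * w (C_l t * x) t - W x)
           @[t --> 0^'-] --> 0%E].

(* Main.v *)
(* At time [t] the approximant [w_n] consists of bumps of height
   [X_k = x_{n,k}(t)] sitting at distance [p_k = (r/A)^k X_k] from the origin and
   separated by gaps, since [p_{k+1} <= r p_k]: the bumps with [|x|/p_k] in
   [[1 - 2r, 1 + 2r]] never reach [r (1 + 2r) < |x|/p_k < 1 - 2r]. The ODE of
   [x_{n,k}] gives [A^k exp(C_k t) <= X_k <= A^k] with [C_k] independent of [n],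
   so all of this survives in the limit [w].
   Suppose [C_w w(C_l x, t) -> W].
   - If [C_l -> 0], then by continuity [C_l(t)] takes, arbitrarily close to
     [t = 0], a value [s p_k(t)] for any prescribed [s > 0]; hence [W] vanishes
     on [(r (1 + 2r), 1 - 2r) / s] for every [s], i.e. [W = 0].
   - If [C_l] is unbounded, [W = 0] because [w] has bounded support. If [C_w] is
     not bounded below while [C_l >= L], [W = 0] because [w] is bounded away from
     the origin, uniformly in time.
   - Otherwise [W] carries, at every scale [p_k / C_l], a copy of the bump with
     height bounded below. Testing with [Phi(C_l x / p_k)], [Phi' = phi], bounds
     the pairing of [W] with this bump by [sup |Phi|] times the integral of [|W'|]
     over [|x| <= 2 p_k / C_l], which tends to [0]: [W'] is not locally
     integrable at the origin. *)
Require Import Defs.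
From mathcomp Require Import all_boot all_order all_algebra.
From mathcomp Require Import all_classical all_reals all_analysis measurable_realfun.
From mathcomp Require Import ring lra.

Set Implicit Arguments.
Unset Strict Implicit.
Unset Printing Implicit Defensive.

Import Order.TTheory GRing.Theory Num.Theory.
Import numFieldNormedType.Exports.

Local Open Scope classical_set_scope.
Local Open Scope ring_scope.

(** * Integrals of continuous functions *)

Section integrable_EFin.
Context d (T : measurableType d) (R : realType).
Variables (mu : {measure set T -> \bar R}) (D : set T).
Hypothesis mD : measurable D.
Implicit Types f g : T -> R.

Lemma integrable_EFinZl (k : R) f : mu.-integrable D (EFin \o f) ->
  mu.-integrable D (EFin \o (fun x => k * f x)).
Proof.
have -> : EFin \o (fun x => k * f x) = (fun x => k%:E * (EFin \o f) x)%E.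
  by apply/funext => x /=; rewrite EFinM.
exact: integrableZl.
Qed.

Lemma integrable_EFinD f g : mu.-integrable D (EFin \o f) ->
  mu.-integrable D (EFin \o g) ->
  mu.-integrable D (EFin \o (fun x => f x + g x)).
Proof.
have -> : EFin \o (fun x => f x + g x) = ((EFin \o f) \+ (EFin \o g))%E.
  by apply/funext => x /=; rewrite EFinD.
exact: integrableD.
Qed.

End integrable_EFin.

Section compact_support.
Context {R : realType}.
Notation mu := (@lebesgue_measure R).
Implicit Types f g : R -> R.

Definition vanishes_beyond (M : R) f := forall x, M < `|x| -> f x = 0.

Lemma vanishes_beyond_restrict M f :
  vanishes_beyond M f -> f \_ `[- M, M] = f.
Proof.
move=> f0; apply/funext => x; rewrite patchE; case: ifPn => //.
rewrite notin_setE/= in_itv/= -ler_norml => /negP; rewrite -ltNge => /f0 ->.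
by [].
Qed.

Lemma continuous_integrable_itv f a b :
  continuous f -> mu.-integrable `[a, b] (EFin \o f).
Proof.
move=> cf; apply: continuous_compact_integrable; first exact: segment_compact.
exact: continuous_subspaceT.
Qed.

Lemma vanishes_beyond_integrable M f :
  continuous f -> vanishes_beyond M f -> mu.-integrable setT (EFin \o f).
Proof.
move=> cf /vanishes_beyond_restrict fE; rewrite -fE -restrict_EFin.
apply/integrable_restrict => //=; rewrite setTI.
exact: continuous_integrable_itv.
Qed.

Lemma Rintegral_vanishes_beyond M f : vanishes_beyond M f ->
  \int[mu]_x f x = \int[mu]_(x in `[- M, M]) f x.
Proof. by move=> /vanishes_beyond_restrict fE; rewrite [RHS]Rintegral_mkcond fE. Qed.

Lemma is_derive_mulrl (m x : R) : is_derive x 1 ( *%R m) m.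
Proof.
by have := @is_deriveZ _ _ _ id m x 1 1 (is_derive_id _ _); rewrite /= [_ *: 1]mulr1.
Qed.

(** Substitution on [[- (M / m), M / m]], which [x -> m * x] carries onto [[- M, M]]; outside these
    intervals both integrands vanish. *)
Lemma Rintegral_scale M f (m : R) : 0 < m -> continuous f ->
  vanishes_beyond M f -> \int[mu]_x (m * f (m * x)) = \int[mu]_x f x.
Proof.
move=> m0 cf fM.
(* [M] may be negative; replacing it by [max M 0] orders the endpoints as the substitution rule
   demands. *)
wlog M0 : M fM / 0 <= M.
  move=> /(_ (Num.max M 0)); apply; last by rewrite le_max lexx orbT.
  by move=> x; rewrite gt_max => /andP[Mx _]; exact: fM.
have gM : vanishes_beyond (M / m) (fun x => m * f (m * x)).
  move=> x; rewrite ltr_pdivrMr// mulrC => xM.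
  by rewrite fM ?mulr0// normrM gtr0_norm.
rewrite (Rintegral_vanishes_beyond fM) (Rintegral_vanishes_beyond gM).
have dm := is_derive_mulrl m.
have dE : derive1 ( *%R m) = cst m.
  by apply/funext => x; rewrite derive1E; exact: derive_val.
have cm : continuous ( *%R m) by move=> x; exact: mulrl_continuous.
have := @integration_by_substitution_increasing R ( *%R m) f (- (M / m)) (M / m).
have -> : m * (M / m) = M by field; lra.
have -> : m * - (M / m) = - M by field; lra.
rewrite /Rintegral => -> //; rewrite ?dE.
- by congr fine; apply: eq_integral => x _ /=; rewrite mulrC.
- by rewrite -subr_ge0 opprK addr_ge0// divr_ge0// ltW.
- by move=> x y _ _; rewrite ltr_pM2l.
- by move=> x _; exact: cst_continuous.
- exact: is_cvg_cst.
- exact: is_cvg_cst.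
- split.
  + by move=> x _; exact: ex_derive.
  + exact/cvg_at_right_filter/cm.
  + exact/cvg_at_left_filter/cm.
- exact: continuous_subspaceT.
Qed.

Lemma ae_eq0_of_sq_integral (D : set R) f : measurable D ->
  measurable_fun D f -> (\int[mu]_(x in D) (f x ^+ 2)%:E = 0)%E ->
  {ae mu, forall x, D x -> f x = 0}.
Proof.
move=> mD mf f0.
have := @ae_eq_integral_abs _ _ R mu D mD (EFin \o (fun x => f x ^+ 2)).
case=> [|+ _]; first by apply/measurable_EFinP; exact: measurable_funX.
case=> [|N [mN N0 sN]].
  by rewrite -[RHS]f0; apply: eq_integral => x _ /=; rewrite ger0_norm// sqr_ge0.
exists N; split => // x /= h; apply: sN => /= h'.
by apply: h => Dx; have /(_ Dx)[/eqP] := h'; rewrite sqrf_eq0 => /eqP.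
Qed.

Lemma sq_integral_of_L2norm f e : measurable_fun setT f ->
  (L2norm f <= e%:E)%E -> (\int[mu]_x (f x ^+ 2)%:E <= (e ^+ 2)%:E)%E.
Proof.
move=> mf fe.
have e0 : 0 <= e by rewrite -lee_fin (le_trans _ fe)// Lnorm_ge0.
have -> : (\int[mu]_x (f x ^+ 2)%:E = L2norm f `^ 2)%E.
  rewrite /L2norm poweR_Lnorm//; apply: eq_integral => x _ /=.
  by rewrite powR_mulrn// -normrX ger0_norm// sqr_ge0.
have -> : ((e ^+ 2)%:E = e%:E `^ 2)%E by rewrite poweR_EFin powR_mulrn.
by apply: gt0_ler_poweR => //; rewrite in_itv/= ?lee_fin ?Lnorm_ge0 ?e0 ?leey.
Qed.

(* AM-GM: [2 |f'| <= f'^2 / e + e], so that Hoelder's inequality is not needed. *)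
Lemma increment_le_L2norm f (e a b : R) : 0 < e -> a <= b ->
  (forall x, derivable f x 1) -> continuous (derive1 f) ->
  (L2norm (derive1 f) <= e%:E)%E -> `|f b - f a| <= e * (1 + (b - a)) / 2.
Proof.
move=> e0; rewrite le_eqVlt => /predU1P[->|ab] df cf fe.
  by rewrite subrr normr0 divr_ge0// mulr_ge0 ?ltW// subrr addr0.
have cff : continuous f by move=> x; exact/differentiable_continuous/derivable1_diffP.
have mf : measurable_fun setT (derive1 f) by exact: continuous_measurable_fun.
have c2 : continuous (fun x => derive1 f x ^+ 2).
  by move=> x; rewrite /continuous_at !expr2; exact: (cvgM (cf x) (cf x)).
have cn : continuous (fun x => `|derive1 f x|).
  by move=> x; apply: cvg_norm; exact: cf.
have i2 := continuous_integrable_itv a b c2.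
have -> : f b - f a = \int[mu]_(x in `[a, b]) derive1 f x.
  rewrite /Rintegral (@continuous_FTC2 _ (derive1 f) f) ?fineK//.
    exact: continuous_subspaceT.
  split; [by move=> x _|exact/cvg_at_right_filter/cff|
         exact/cvg_at_left_filter/cff].
apply: le_trans (le_normr_Rintegral _ (continuous_integrable_itv a b cf)) _ => //.
pose g := fun x => (2 * e)^-1 * derive1 f x ^+ 2 + e / 2.
have cg : continuous g.
  by move=> x; apply: cvgD; [apply: cvgM; [exact: cvg_cst|exact: c2]|exact: cvg_cst].
have cg1 : continuous (fun x => (2 * e)^-1 * derive1 f x ^+ 2).
  by move=> x; apply: cvgM; [exact: cvg_cst|exact: c2].
apply: (@le_trans _ _ (\int[mu]_(x in `[a, b]) g x)).
  apply: le_Rintegral => //; [exact: continuous_integrable_itv..|].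
  move=> x _; rewrite /g -[derive1 f x ^+ 2]real_normK ?num_real//.
  move: `|_| => y; rewrite -subr_ge0.
  have -> : (2 * e)^-1 * y ^+ 2 + e / 2 - y = (2 * e)^-1 * (y - e) ^+ 2.
    by field; lra.
  by rewrite mulr_ge0 ?sqr_ge0// invr_ge0 mulr_ge0// ltW.
rewrite /g RintegralD//; last first.
- by apply: continuous_integrable_itv => x; exact: cvg_cst.
- exact: continuous_integrable_itv.
rewrite (@RintegralZl _ _ _ mu `[a, b] (fun x => derive1 f x ^+ 2))//.
rewrite (@Rintegral_cst _ _ _ mu `[a, b] _ (e / 2))//.
have -> : fine (mu `[a, b]) = b - a by rewrite lebesgue_measure_itv/= lte_fin ab.
have : \int[mu]_(x in `[a, b]) (derive1 f x ^+ 2) <= e ^+ 2.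
  rewrite -lee_fin /Rintegral fineK ?integrable_fin_num//.
  apply: le_trans (sq_integral_of_L2norm mf fe).
  apply: ge0_subset_integral => //.
    by apply/measurable_EFinP; exact: measurable_funX.
  by move=> x _; rewrite lee_fin sqr_ge0.
set I := Rintegral _ _ _ => Ie.
have -> : e * (1 + (b - a)) / 2 = (2 * e)^-1 * e ^+ 2 + e / 2 * (b - a).
  by field; lra.
by rewrite lerD2r ler_pM2l// invr_gt0 mulr_gt0.
Qed.

End compact_support.

(** * Scalar linear differential equations *)

Section one_sided_derivative.
Context {R : realType}.
Implicit Types (f : R -> R) (J : set R).

Lemma has_deriv_within_small J f t l : has_deriv_within J f t l ->
  forall e, 0 < e -> exists2 d, 0 < d & forall s, J s -> `|s - t| < d ->
    `|f s - f t - l * (s - t)| <= e * `|s - t|.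
Proof.
move=> /cvgrPdist_le h e e0; have [d /= d0 hd] := h e e0; exists d => // s Js sd.
have [->|st] := eqVneq s t; first by rewrite !subrr mulr0 subr0 normr0 mulr0.
have := hd s; rewrite /ball_/= distrC => /(_ sd st Js).
have st0 : `|s - t| != 0 by rewrite normr_eq0 subr_eq0.
rewrite /dquot -(ler_pM2r (_ : 0 < `|s - t|)) ?normr_gt0 ?subr_eq0//.
rewrite -normrM mulrBl divfK ?subr_eq0//.
by rewrite [in X in X -> _]distrC.
Qed.

Lemma has_deriv_within_near J f t l : has_deriv_within J f t l ->
  forall e, 0 < e -> exists2 d, 0 < d & forall s, J s -> `|s - t| < d ->
    `|f s - f t| <= e.
Proof.
move=> /has_deriv_within_small/(_ 1 ltr01)[d d0 hd] e e0.
have l1 : 0 < 1 + `|l| by rewrite ltr_wpDr.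
exists (Num.min d (e / (1 + `|l|))); first by rewrite lt_min d0 divr_gt0.
move=> s Js; rewrite lt_min ltr_pdivlMr// => /andP[sd se].
have := hd s Js sd; rewrite mul1r => h.
apply: le_trans (ltW se); rewrite mulrDr mulr1.
rewrite -[f s - f t](subrK (l * (s - t))) (le_trans (ler_normD _ _))//.
by rewrite lerD// normrM mulrC.
Qed.

Lemma within_continuousP (A : set R) f :
  {within A, continuous f} <->
  (forall x, A x -> forall e, 0 < e -> exists2 d, 0 < d &
    forall s, A s -> `|s - x| < d -> `|f s - f x| <= e).
Proof.
rewrite continuous_subspace_in; split=> h x.
- move=> Ax; have : f @ within A (nbhs x) --> f x.
    by rewrite nbhs_subspace_in//; apply: (h x); rewrite inE.
  move/cvgrPdist_le => hx e e0; have [d /= d0 hd] := hx e e0.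
  exists d => // s As sd; rewrite distrC; apply: hd => //.
  by rewrite /ball_/= distrC.
- rewrite inE => Ax; suff : f @ within A (nbhs x) --> f x.
    by rewrite nbhs_subspace_in.
  apply/cvgrPdist_le => e e0; have [d d0 hd] := h x Ax e e0.
  exists d => //= s; rewrite /ball_/= distrC => sd As.
  by rewrite distrC; exact: hd.
Qed.

(** An interior point has a full neighbourhood inside [[a, b]], so there the relative difference
    quotient is the ordinary one. *)
Lemma has_deriv_within_itv (a b : R) f f' :
  (forall t, t \in `[a, b] -> has_deriv_within `[a, b] f t (f' t)) ->
  {within `[a, b], continuous f} /\
  (forall t, t \in `]a, b[ -> is_derive t 1 f (f' t)).
Proof.
move=> df; split.
- by apply/within_continuousP => t tab; exact: has_deriv_within_near (df t tab).
- move=> t tab.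
  have tab' : t \in `[a, b] by apply: subset_itv_oo_cc.
  suff h : h^-1 *: (f (h *: 1 + t) - f t) @[h --> 0^'] --> f' t.
    by apply: DeriveDef; [apply/cvg_ex; exists (f' t)|exact/cvg_lim].
  apply/cvgrPdist_le => e e0.
  have [d d0 hd] := has_deriv_within_small (df t tab') e0.
  have [c c0 hc] : exists2 c, 0 < c & forall s, `|s - t| < c -> s \in `[a, b].
    move: tab; rewrite in_itv/= => /andP[ta tb].
    exists (Num.min (t - a) (b - t)); first by rewrite lt_min !subr_gt0 ta.
    by move=> s; rewrite lt_min !ltr_norml in_itv/= => /andP[/andP[? _] /andP[_ ?]]; lra.
  near=> h.
  have h0 : h != 0 by near: h; exact: nbhs_dnbhs_neq.
  have hcd : `|h| < Num.min c d.
    by near: h; apply: dnbhs0_lt; rewrite lt_min c0.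
  move: hcd; rewrite lt_min => /andP[hhc hhd].
  rewrite [_ *: 1]mulr1.
  have E : h + t - t = h by rewrite addrK.
  have := hd (h + t); rewrite E => /(_ (hc _ _) hhd); rewrite E => /(_ hhc) hle.
  rewrite -(ler_pM2r (_ : 0 < `|h|)) ?normr_gt0// -normrM mulrBl distrC.
  by rewrite [_ *: _]mulrC divfK.
Unshelve. all: by end_near. Qed.

End one_sided_derivative.

Section gronwall.
Context {R : realType}.
Implicit Types (x y h : R -> R).

(* The square is used so that no sign of [x] has to be known beforehand. *)
Lemma linear_ode_bounds (T C : R) x h : 0 < T -> 0 <= C ->
  (forall t, t \in `[- T, 0] -> 0 <= h t <= C) ->
  (forall t, t \in `[- T, 0] -> has_deriv_within `[- T, 0] x t (x t * h t)) ->
  0 < x 0 ->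
  forall t, t \in `[- T, 0] -> x 0 * expR (C * t) <= x t <= x 0.
Proof.
move=> T0 C0 hC dx x0 t tT; have [cx dx'] := has_deriv_within_itv dx.
have I0 : (0 : R) \in `[- T, 0] by rewrite in_itv/= lexx andbT oppr_le0 ltW.
have t0 : t <= 0 by move: tT; rewrite in_itv/= => /andP[].
(* Here [q' = 2 h x^2 >= 0], so [q] is nondecreasing and largest at time [0]. *)
pose q s := x s ^+ 2.
have dq s : s \in `]- T, 0[ -> is_derive s 1 q (2 * h s * x s ^+ 2).
  move=> sT; have := dx' s sT => ?.
  apply: is_derive_eq; rewrite /GRing.scale/=; ring.
have cq : {within `[- T, 0], continuous q}.
  by move=> s; apply: cvgM; exact: cx.
have qle : q t <= q 0.
  apply: (@ger0_derive1_le_cc _ q (- T) 0) => // s sT.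
    by have := dq s sT => ?; exact: ex_derive.
  have := dq s sT => ?; rewrite derive1E derive_val.
  have /andP[h0 _] := hC s (subset_itv_oo_cc sT).
  by rewrite mulr_ge0 ?sqr_ge0// mulr_ge0.
(* Integrating factor: [h <= C] makes [p] nonincreasing, and [p 0 <= p s] is the lower bound for
   [x s ^+ 2]. *)
pose p s := q s * expR (- 2 * C * s).
have dp s : s \in `]- T, 0[ ->
    is_derive s 1 p (expR (- 2 * C * s) * (2 * (h s - C) * x s ^+ 2)).
  move=> sT; have := dq s sT => ?.
  apply: is_derive_eq; rewrite /GRing.scale/=; rewrite /q; ring.
have pge s : s \in `[- T, 0] -> p 0 <= p s.
  move=> sT; have s0 : s <= 0 by move: sT; rewrite in_itv/= => /andP[].
  apply: (@ler0_derive1_le_cc _ p (- T) 0) => // [{sT s0}s sT|{sT s0}s sT|].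
  - by have := dp s sT => ?; exact: ex_derive.
  - have := dp s sT => ?; rewrite derive1E derive_val.
    have /andP[_ hs] := hC s (subset_itv_oo_cc sT).
    rewrite mulr_ge0_le0 ?expR_ge0// mulr_le0_ge0 ?sqr_ge0//.
    by rewrite pmulr_rle0// subr_le0.
  - move=> {sT s0}s; apply: cvgM; first exact: cq.
    apply: continuous_subspaceT => {}s.
    apply: continuous_comp; last exact: continuous_expR.
    exact: mulrl_continuous.
have xE s : s \in `[- T, 0] -> x 0 ^+ 2 * expR (2 * C * s) <= x s ^+ 2.
  move=> /pge; rewrite /p mulr0 expR0 mulr1 /q => h1.
  by rewrite -ler_pdivlMr ?expR_gt0// -expRN -mulNr -mulNr.
(* If [x t <= 0 < x 0], then [x] has a zero in between, where the positive lower bound for its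
   square fails. *)
have xt0 : 0 < x t.
  rewrite ltNge; apply/negP => xt.
  have ct : {within `[t, 0], continuous x}.
    apply: continuous_subspaceW cx; apply: subset_itvr.
    by move: tT; rewrite in_itv/= bnd_simp => /andP[].
  have [|c ctT xc] := @IVT _ x t 0 0 t0 ct.
    by rewrite ge_min xt/= le_max (ltW x0) orbT.
  have cT : c \in `[- T, 0].
    by move: ctT tT; rewrite !in_itv/= => /andP[? ->] /andP[? _]; rewrite andbT; lra.
  by have := xE c cT; rewrite xc expr0n/= leNgt mulr_gt0 ?exprn_gt0 ?expR_gt0.
apply/andP; split.
- rewrite -(@ler_pXn2r _ 2) ?nnegrE ?(ltW xt0) ?mulr_ge0 ?expR_ge0 ?(ltW x0)//.
  by rewrite exprMn -expRM_natl mulrA xE.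
- by rewrite -(@ler_pXn2r _ 2) ?nnegrE// ltW.
Qed.

(** The quotient satisfies [(y / x)' = (y / x) * (h' - h) >= 0], hence is largest at the final time
    [0]. *)
Lemma ratio_le (T : R) x y h h' : 0 < T ->
  (forall t, t \in `[- T, 0] -> 0 < x t /\ 0 < y t) ->
  (forall t, t \in `[- T, 0] -> h t <= h' t) ->
  (forall t, t \in `[- T, 0] -> has_deriv_within `[- T, 0] x t (x t * h t)) ->
  (forall t, t \in `[- T, 0] -> has_deriv_within `[- T, 0] y t (y t * h' t)) ->
  forall t, t \in `[- T, 0] -> y t / x t <= y 0 / x 0.
Proof.
move=> T0 xy0 hh dx dy t tT.
have [cx dx'] := has_deriv_within_itv dx; have [cy dy'] := has_deriv_within_itv dy.
have I0 : (0 : R) \in `[- T, 0] by rewrite in_itv/= lexx andbT oppr_le0 ltW.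
have t0 : t <= 0 by move: tT; rewrite in_itv/= => /andP[].
pose q s := y s / x s.
have dq s : s \in `]- T, 0[ -> is_derive s 1 q (q s * (h' s - h s)).
  move=> sT; have := dx' s sT => ?; have := dy' s sT => ?.
  have [x0 _] := xy0 s (subset_itv_oo_cc sT).
  have x0' : x s != 0 by rewrite gt_eqF.
  apply: is_derive_eq; rewrite /GRing.scale/= /q; field.
  exact: x0'.
apply: (@ger0_derive1_le_cc _ q (- T) 0) => // [s sT|s sT|].
- by have := dq s sT => ?; exact: ex_derive.
- have := dq s sT => ?; rewrite derive1E derive_val.
  have [x0 y0] := xy0 s (subset_itv_oo_cc sT).
  apply: mulr_ge0; first by rewrite divr_ge0 ?ltW.
  by rewrite subr_ge0; apply: hh; exact: subset_itv_oo_cc.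
- move=> s; apply: cvgM; first exact: cy.
  apply: (@within_continuous_comp _ _ _ _ x GRing.inv) => // z.
  rewrite inE => -[c cT <-]; apply: inv_continuous.
  by rewrite gt_eqF//; have [] := xy0 c cT.
Qed.

End gronwall.

(** * The bump *)

Section smooth_functions.
Context {R : realType}.
Notation mu := (@lebesgue_measure R).
Implicit Types f g : R -> R.

Lemma smooth_continuous f : smooth f -> continuous f.
Proof.
move=> sf x; apply/differentiable_continuous/derivable1_diffP.
exact: (sf 0%N).
Qed.

Lemma smooth_derive1 f : smooth f -> smooth (derive1 f).
Proof. by move=> sf n x; rewrite -derive1Sn; exact: sf. Qed.

(** The [n]-th derivative is [m ^+ n] times that of [f] at [m * x]; the induction carries this
    formula together with its differentiability. *)
Lemma smooth_scale f (m : R) : smooth f -> smooth (fun x => f (m * x)).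
Proof.
move=> sf n; suff [nE dn] : derive1n n (fun x => f (m * x)) =
    (fun x => m ^+ n * derive1n n f (m * x)) /\
    forall x, derivable (fun x => m ^+ n * derive1n n f (m * x)) x 1.
  by rewrite nE.
have d k (x : R) : is_derive x 1 (fun x : R => m ^+ k * derive1n k f (m * x))
    (m ^+ k.+1 * derive1n k.+1 f (m * x)).
  have dm := is_derive_mulrl m x.
  have df : is_derive (m * x) 1 (derive1n k f) (derive1n k.+1 f (m * x)).
    by rewrite derive1nS derive1E; apply: derivableP; exact: sf.
  have := @is_derive1_comp _ (derive1n k f) ( *%R m) x _ _ df dm.
  move=> /(@is_deriveZ _ _ _ _ (m ^+ k)); rewrite [_ *: _]mulrC -mulrA -exprS mulrC.
  exact.
elim: n => [|n [IH _]].
  by split=> [|x]; [apply/funext => x; rewrite mul1r|have ? := d 0%N x; exact: ex_derive].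
split=> [|x]; last by have ? := d n.+1 x; exact: ex_derive.
apply/funext => x; rewrite derive1nS IH derive1E; have ? := d n x.
exact: derive_val.
Qed.

Lemma smoothB f g : smooth f -> smooth g -> smooth (fun x => f x - g x).
Proof.
move=> sf sg n; suff nE : derive1n n (fun x => f x - g x) =
    (fun x => derive1n n f x - derive1n n g x).
  by rewrite nE => x; apply: derivableB; [exact: sf|exact: sg].
elim: n => [//|n IH]; rewrite derive1nS IH; apply/funext => x.
rewrite !derive1nS !derive1E; apply: deriveB; [exact: sf|exact: sg].
Qed.

(** Near [0] the numerator vanishes, so the quotient is identically [0] there, its value at [0]
    included. *)
Lemma continuous_divN (d : R) f : 0 < d -> continuous f ->
  (forall x, `|x| < d -> f x = 0) -> continuous (fun x => f x / (- x)).
Proof.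
move=> d0 cf fd x; have [->|x0] := eqVneq x 0.
  apply/cvgrPdist_le => e e0; exists d => //= y.
  rewrite /ball_/= sub0r normrN => /fd ->.
  by rewrite oppr0 invr0 mulr0 mul0r subrr normr0 ltW.
apply: cvgM; first exact: cf.
by apply: cvgV; [rewrite oppr_eq0|exact: cvgN].
Qed.

Lemma Rintegral_gt0 M g x0 : continuous g -> vanishes_beyond M g ->
  (forall x, 0 <= g x) -> 0 < g x0 -> 0 < \int[mu]_x g x.
Proof.
move=> cg gM g0 gx0.
have [d d0 hd] : exists2 d, 0 < d & forall x, x \in `[x0 - d, x0 + d] -> g x0 / 2 <= g x.
  have /cvgrPdist_le/(_ (g x0 / 2)) := cg x0; rewrite divr_gt0// => /(_ isT).
  case=> d /= d0 hd; exists (d / 2); first by rewrite divr_gt0.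
  move=> x; rewrite in_itv/= => /andP[h1 h2].
  have : `|g x0 - g x| <= g x0 / 2.
    by apply: hd; rewrite /ball_/= ltr_norml; apply/andP; split; lra.
  by rewrite ler_norml => /andP[? ?]; lra.
apply: (@lt_le_trans _ _ (\int[mu]_(x in `[x0 - d, x0 + d]) g x)).
  apply: (@lt_le_trans _ _ (\int[mu]_(x in `[x0 - d, x0 + d]) (g x0 / 2))).
    rewrite (@Rintegral_cst _ _ _ mu `[x0 - d, x0 + d] _ (g x0 / 2))//.
    have -> : fine (mu `[x0 - d, x0 + d]) = d + d.
      by rewrite lebesgue_measure_itv/= lte_fin ifT/=; [ring|lra].
    by rewrite mulr_gt0 ?divr_gt0 ?addr_gt0.
  apply: le_Rintegral => //.
  - by apply: continuous_integrable_itv => x; exact: cvg_cst.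
  - exact: continuous_integrable_itv.
have ig := vanishes_beyond_integrable cg gM.
rewrite /Rintegral; apply: fine_le; [|exact: integrable_fin_num|].
  by apply: integrable_fin_num => //; exact: continuous_integrable_itv.
apply: ge0_subset_integral => //; first by case/integrableP : ig.
by move=> x _; rewrite lee_fin.
Qed.

End smooth_functions.

Section bump.
Context {R : realType}.
Notation mu := (@lebesgue_measure R).
Variables (r : R) (rho : R -> R).
Hypothesis hr : 0 < r <= 4^-1.
Hypothesis hrho : admissible_bump r rho.
Notation phi := (odd_bump rho).

Lemma smooth_odd_bump : smooth phi.
Proof.
have [srho _ _ _ _] := hrho.
apply: smoothB => //.
have -> : (fun x => rho (- x)) = (fun x => rho (-1 * x)).
  by apply/funext => x; rewrite mulN1r.
exact: smooth_scale.
Qed.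

Lemma continuous_odd_bump : continuous phi.
Proof. exact/smooth_continuous/smooth_odd_bump. Qed.

Lemma bump_eq0 x : ~~ (1 - r <= x <= 1 + r) -> rho x = 0.
Proof.
have [_ _ rho0 _ _] := hrho => h.
by apply/eqP; apply/negPn; apply/negP => /rho0; exact/negP.
Qed.

Lemma odd_bump_eq0 x : ~~ (1 - r <= `|x| <= 1 + r) -> phi x = 0.
Proof.
have /andP[r0 r4] := hr.
move=> h; rewrite /odd_bump.
have -> : rho (- x) = 0.
  by apply: bump_eq0; apply: contra h => /andP[? ?]; rewrite ler0_norm; lra.
have -> : rho x = 0.
  by apply: bump_eq0; apply: contra h => /andP[? ?]; rewrite ger0_norm; lra.
by rewrite subrr.
Qed.

Lemma vanishes_beyond_odd_bump : vanishes_beyond 2 phi.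
Proof.
have /andP[r0 r4] := hr.
move=> x x2; apply: odd_bump_eq0; rewrite negb_and -!ltNge; lra.
Qed.

(** [phi] is nonnegative on the left and nonpositive on the right of the origin. The expression is
    the integrand of [pi] times the Hilbert transform of [phi] at [0]. *)
Lemma odd_bump_div_ge0 x : 0 <= phi x / (- x).
Proof.
have /andP[r0 r4] := hr.
have [_ rho0 _ _ _] := hrho.
have [x0|x0] := leP x 0.
  rewrite /odd_bump (@bump_eq0 x); last by rewrite negb_and -!ltNge; lra.
  by rewrite subr0 divr_ge0// oppr_ge0.
rewrite /odd_bump (@bump_eq0 (- x)); last by rewrite negb_and -!ltNge; lra.
by rewrite sub0r invrN mulrNN divr_ge0// ltW.
Qed.

Lemma continuous_odd_bump_div : continuous (fun x => phi x / (- x)).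
Proof.
have /andP[r0 r4] := hr.
apply: (@continuous_divN _ (1 - r)); [lra|exact: continuous_odd_bump|].
by move=> x xr; apply: odd_bump_eq0; rewrite negb_and -!ltNge xr.
Qed.

(** A bump that vanishes identically would have Hilbert transform [0] at the origin, against the
    normalization [- 2^-1]. *)
Lemma bump_neq0 : exists x, rho x != 0.
Proof.
have [_ _ _ _ h] := hrho.
apply: contrapT => /forallNP rho0.
have {}rho0 x : rho x = 0 by apply/eqP; have /negP := rho0 x; rewrite negbK.
move: h; rewrite /hilbert (_ : hilbert_trunc rho 0 = cst 0).
  by rewrite lim_cst// mulr0 => /eqP; rewrite eq_sym oppr_eq0 invr_eq0 pnatr_eq0.
apply/funext => d; rewrite /hilbert_trunc /Rintegral.
under eq_integral do rewrite rho0 mul0r.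
by rewrite integral0.
Qed.

Lemma odd_bump_neq0 : exists2 x, 0 < x & phi x != 0.
Proof.
have /andP[r0 r4] := hr.
have [x rx] := bump_neq0; have [_ _ rho0 _ _] := hrho.
have /andP[h1 h2] := rho0 x rx; exists x; first by lra.
rewrite /odd_bump (@bump_eq0 (- x)) ?sub0r ?oppr_eq0//.
by rewrite negb_and -!ltNge; lra.
Qed.

Lemma odd_bump_div_integral_gt0 : 0 < \int[mu]_x (phi x / (- x)).
Proof.
have [x x0 px] := odd_bump_neq0.
apply: (@Rintegral_gt0 _ 2 _ x) => //.
- exact: continuous_odd_bump_div.
- by move=> y y2; rewrite vanishes_beyond_odd_bump// mul0r.
- exact: odd_bump_div_ge0.
- by rewrite lt_def odd_bump_div_ge0 andbT mulf_neq0// invr_eq0 oppr_eq0 gt_eqF.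
Qed.

Lemma odd_bump_sq_integral_gt0 : 0 < \int[mu]_x (phi x ^+ 2).
Proof.
have [x x0 px] := odd_bump_neq0.
apply: (@Rintegral_gt0 _ 2 _ x) => //.
- move=> y; rewrite /continuous_at !expr2.
  by apply: cvgM; exact: continuous_odd_bump.
- by move=> y y2; rewrite vanishes_beyond_odd_bump// expr0n.
- by move=> y; exact: sqr_ge0.
- by rewrite lt_def sqr_ge0 andbT expf_neq0.
Qed.

(** The two mirror-image bumps cancel. This is what gives [phi] a compactly supported primitive. *)
Lemma odd_bump_integral : \int[mu]_x phi x = 0.
Proof.
have /andP[r0 r4] := hr.
have [srho _ _ _ _] := hrho; have crho := smooth_continuous srho.
have rho2 : vanishes_beyond 2 rho.
  move=> x x2; apply: bump_eq0; apply/negP => /andP[h1 h2].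
  by move: x2; rewrite ger0_norm; lra.
have rhoN2 : vanishes_beyond 2 (fun x => rho (- x)).
  by move=> x x2; rewrite rho2// normrN.
have crhoN : continuous (fun x => rho (- x)).
  by move=> x; apply: continuous_comp; [exact: continuousN|exact: crho].
rewrite /odd_bump RintegralB//; last first.
- exact: vanishes_beyond_integrable crho rho2.
- exact: vanishes_beyond_integrable crhoN rhoN2.
apply/eqP; rewrite subr_eq0; apply/eqP.
rewrite (Rintegral_vanishes_beyond rho2) (Rintegral_vanishes_beyond rhoN2).
rewrite /Rintegral; congr fine.
have := @integration_by_substitution_oppr R rho (- 2) 2.
by rewrite opprK => -> //; [lra|exact: continuous_subspaceT].
Qed.

Definition bump_primitive (x : R) : R := \int[mu]_(t in `]-oo, x]) phi t.

Lemma is_derive_bump_primitive (x : R) : is_derive x 1 bump_primitive (phi x).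
Proof.
have i : mu.-integrable `]-oo, x + 1] (EFin \o phi).
  apply: integrableS (vanishes_beyond_integrable continuous_odd_bump
    vanishes_beyond_odd_bump) => //.
have xx : x < x + 1 by rewrite ltrDl.
have := @continuous_FTC1 R phi -oo%O x (x + 1) xx i.
case=> [||d <-]; first by rewrite /= ltNyr.
  by move=> ?; exact: continuous_odd_bump.
by rewrite derive1E; exact: derivableP.
Qed.

Lemma smooth_bump_primitive : smooth bump_primitive.
Proof.
have dE : derive1 bump_primitive = phi.
  apply/funext => x; rewrite derive1E.
  by have := is_derive_bump_primitive x => ?; exact: derive_val.
move=> [|n] x; last by rewrite derive1Sn dE; exact: smooth_odd_bump.
by have := is_derive_bump_primitive x => ?; exact: ex_derive.
Qed.

(** To the left of the support nothing has been integrated yet; to the right the full integral has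
    been collected, and it is zero. *)
Lemma vanishes_beyond_bump_primitive : vanishes_beyond 2 bump_primitive.
Proof.
move=> x x2; rewrite /bump_primitive Rintegral_mkcond.
have [x0|x0] := leP x 0.
  have -> : phi \_ `]-oo, x] = cst 0.
    apply/funext => y; rewrite patchE; case: ifPn => //.
    rewrite inE/= in_itv/= => yx; apply: vanishes_beyond_odd_bump.
    by move: x2; rewrite !ler0_norm; lra.
  by rewrite /Rintegral integral0.
have -> : phi \_ `]-oo, x] = phi.
  apply/funext => y; rewrite patchE; case: ifPn => //.
  rewrite notin_setE/= in_itv/= => /negP; rewrite -ltNge => xy.
  by rewrite vanishes_beyond_odd_bump// (lt_trans x2)// !gtr0_norm//; lra.
exact: odd_bump_integral.
Qed.

End bump.

(** * Convergence in weighted L2 *)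

Section local_convergence.
Context {R : realType}.
Notation mu := (@lebesgue_measure R).
Variables (T : R) (om W : R -> R) (F : R -> R -> R).
Hypothesis wom : weight om.
Hypothesis mW : measurable_fun setT W.
Hypothesis mF : forall t, t \in `[- T, 0[ -> measurable_fun setT (F t).
Hypothesis FW : weighted_L2sq om (fun x => F t x - W x) @[t --> 0^'-] --> 0%E.

(** On the compact interval the weight is at least some [c > 0], so the weighted integral dominates
    [c] times the plain one. *)
Lemma local_L2_cvg (M e : R) : 0 < e -> exists2 d, 0 < d &
  forall t, - d < t < 0 -> t \in `[- T, 0[ ->
    mu.-integrable `[- M, M] (EFin \o (fun x => (F t x - W x) ^+ 2)) /\
    \int[mu]_(x in `[- M, M]) ((F t x - W x) ^+ 2) <= e.
Proof.
move=> e0; have [mom om0 /(_ `[- M, M]%classic)] := wom.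
case; first exact: segment_compact.
move=> c c0 hc.
have ce0 : 0 < c * e by rewrite mulr_gt0.
have : nbhs (0%E : \bar R) [set y | (y < (c * e)%:E)%E].
  by apply: open_nbhs_nbhs; split; [exact: open_ereal_lt_ereal|rewrite /= lte_fin].
move/FW => [d /= d0 hd]; exists d => // t /andP[dt t0] tT.
have {hd} := hd t; rewrite /ball_/= sub0r normrN ltr0_norm// ltrNl => /(_ dt t0) ht.
have mg : measurable_fun setT (fun x => (F t x - W x) ^+ 2).
  by apply: measurable_funX; apply: measurable_funB => //; exact: mF.
have mgD : measurable_fun `[- M, M] (fun x => (F t x - W x) ^+ 2).
  exact: measurable_funTS.
have le : (\int[mu]_(x in `[(- M)%R, M]) ((F t x - W x) ^+ 2)%:E <= e%:E)%E.
  have c0' : (0 < c%:E)%E by rewrite lte_fin.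
  rewrite -(lee_pmul2l _ c0')//.
  apply: le_trans (ltW ht).
  rewrite -ge0_integralZl//; last 3 first.
  - exact/measurable_EFinP.
  - by move=> x _; rewrite lee_fin sqr_ge0.
  - by rewrite lee_fin ltW.
  have mog : measurable_fun setT (fun x => (om x * (F t x - W x) ^+ 2)%:E).
    by apply/measurable_EFinP; apply: measurable_funM.
  apply: (@le_trans _ _ (\int[mu]_(x in `[(- M)%R, M]) (om x * (F t x - W x) ^+ 2)%:E)%E).
    apply: ge0_le_integral => //.
    - by move=> x _; rewrite mule_ge0 ?lee_fin ?sqr_ge0// ltW.
    - by apply: measurable_funeM; exact/measurable_EFinP.
    - exact: measurable_funTS.
    - move=> x xM; rewrite -EFinM lee_fin ler_wpM2r ?sqr_ge0//.
      exact: hc.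
  apply: ge0_subset_integral => //.
  by move=> x _; rewrite lee_fin mulr_ge0 ?sqr_ge0// ltW.
have ig : mu.-integrable `[- M, M] (EFin \o (fun x => (F t x - W x) ^+ 2)).
  apply/integrableP; split; first exact/measurable_EFinP.
  under eq_integral do rewrite /= ger0_norm ?sqr_ge0//.
  by rewrite (le_lt_trans le)// ltry.
split => //; rewrite -lee_fin /Rintegral fineK//.
exact: integrable_fin_num.
Qed.

(** Pointwise [W^2 <= 2 (F - W)^2 + 2 F^2], the difference being [(W - 2 F)^2]. At suitable times
    close to [0] both terms have small integral over [E], so the integral of [W^2] there is zero. *)
Lemma limit_ae_eq0 (E : set R) (M : R) : 0 < M -> measurable E ->
  (forall x, E x -> `|x| <= M) ->
  (forall d e : R, 0 < d -> 0 < e -> exists t : R, [/\ - d < t < 0,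
     t \in `[- T, 0[ & forall x, E x -> `|F t x| <= e]) ->
  {ae mu, forall x, E x -> W x = 0}.
Proof.
move=> M0 mE EM small; apply: ae_eq0_of_sq_integral => //; first exact: measurable_funTS.
apply/eqP; rewrite eq_le integral_ge0 ?andbT; last by move=> x _; rewrite lee_fin sqr_ge0.
apply/lee_addgt0Pr => e e0; rewrite add0e.
(* The budget [e] is split evenly: [2 * (e / 4)] for the distance of [F] to [W], and
   [2 * (e / (8 * M))] times the length [2 * M] for [F] itself. *)
have [d d0 hd] := @local_L2_cvg M (e / 4) (divr_gt0 e0 (ltr0n _ 4)).
have [|t [td tT ht]] := small d (Num.sqrt (e / (8 * M))) d0.
  by rewrite sqrtr_gt0 divr_gt0// mulr_gt0.
have [ig le] := hd t td tT.
have i1 : mu.-integrable `[- M, M] (EFin \o (fun x => 2 * (F t x - W x) ^+ 2)).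
  exact: integrable_EFinZl.
have i2 : mu.-integrable `[- M, M] (EFin \o (fun x : R => 2 * (e / (8 * M)))).
  by apply: continuous_integrable_itv => x; exact: cvg_cst.
have i3 : mu.-integrable `[- M, M]
    (EFin \o (fun x => 2 * (F t x - W x) ^+ 2 + 2 * (e / (8 * M)))).
  exact: integrable_EFinD.
have q0 : 0 <= e / (8 * M) by rewrite divr_ge0 ?mulr_ge0// ltW.
have p0 x : 0 <= 2 * (F t x - W x) ^+ 2 + 2 * (e / (8 * M)).
  by rewrite addr_ge0// mulr_ge0// sqr_ge0.
have m3 : measurable_fun `[- M, M]
    (EFin \o (fun x => 2 * (F t x - W x) ^+ 2 + 2 * (e / (8 * M)))).
  by case/integrableP : i3.
have sub : E `<=` `[- M, M].
  by move=> x /EM; rewrite ler_norml /= in_itv.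
apply: (@le_trans _ _ (\int[mu]_(x in E)
    (2 * (F t x - W x) ^+ 2 + 2 * (e / (8 * M)))%:E)%E).
  apply: ge0_le_integral => //.
  - by move=> x _; rewrite lee_fin sqr_ge0.
  - by apply/measurable_EFinP; apply: measurable_funX; exact: measurable_funTS.
  - exact: measurable_funS m3.
  - move=> x Ex; rewrite lee_fin.
    have : F t x ^+ 2 <= e / (8 * M).
      by rewrite -(sqr_sqrtr q0) -real_normK ?num_real// ler_pXn2r ?nnegrE ?ht// sqrtr_ge0.
    have : 0 <= (W x - 2 * F t x) ^+ 2 by exact: sqr_ge0.
    by nra.
apply: (@le_trans _ _ (\int[mu]_(x in `[(- M)%R, M])
    (2 * (F t x - W x) ^+ 2 + 2 * (e / (8 * M)))%:E)%E).
  by apply: ge0_subset_integral => // x _; rewrite lee_fin.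
rewrite -[leLHS]fineK; last exact: integrable_fin_num.
rewrite lee_fin -/(Rintegral mu `[- M, M] _) RintegralD//.
rewrite (@RintegralZl _ _ _ mu `[- M, M] (fun x => (F t x - W x) ^+ 2))//.
rewrite (@Rintegral_cst _ _ _ mu `[- M, M] _ (2 * (e / (8 * M))))//.
have -> : fine (mu `[- M, M]) = M + M.
  by rewrite lebesgue_measure_itv/= lte_fin ifT/= ?opprK//; lra.
have -> : 2 * (e / (8 * M)) * (M + M) = e / 2 by field; lra.
by lra.
Qed.

End local_convergence.

Lemma vanishes_beyond_bounded (R : realType) (M : R) (f : R -> R) :
  continuous f -> vanishes_beyond M f ->
  exists2 B, 0 < B & forall x, `|f x| <= B.
Proof.
move=> cf fM.
have cn : {within `[- `|M|, `|M|], continuous (fun x => `|f x|)}.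
  by apply: continuous_subspaceT => x; apply: cvg_norm; exact: cf.
have MM : - `|M| <= `|M| by rewrite (le_trans _ (normr_ge0 M))// oppr_le0.
have [c _ hc] := EVT_max MM cn.
(* Adding [1] keeps the bound positive even if [f] is zero. *)
exists (`|f c| + 1) => [|x]; first by rewrite ltr_wpDl.
have [xM|xM] := leP `|x| `|M|.
  by rewrite (le_trans (hc x _)) ?lerDl// in_itv/= -ler_norml.
by rewrite fM ?normr0 ?addr_ge0// (le_lt_trans (ler_norm M)).
Qed.

(** * Pairing the profile with concentrated copies of the bump *)

Section pairing.
Context {R : realType}.
Notation mu := (@lebesgue_measure R).
Variables (r : R) (rho : R -> R).
Hypothesis hr : 0 < r <= 4^-1.
Hypothesis hrho : admissible_bump r rho.
Notation phi := (odd_bump rho).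

Variables (T : R) (om W V : R -> R) (F : R -> R -> R).
Hypothesis wom : weight om.
Hypothesis mW : measurable_fun setT W.
Hypothesis mF : forall t, t \in `[- T, 0[ -> measurable_fun setT (F t).
Hypothesis FW : weighted_L2sq om (fun x => F t x - W x) @[t --> 0^'-] --> 0%E.
Hypothesis WV : weak_derivative W V.

Lemma locally_integrable_itv (f : R -> R) (a b : R) : locally_integrable setT f ->
  mu.-integrable `[a, b] (EFin \o f).
Proof.
case=> mf _ fK; apply/integrableP; split.
  by apply/measurable_EFinP; exact: measurable_funTS.
exact: (fK _ _ (@segment_compact _ a b)).
Qed.

Lemma Rintegral_supported (f : R -> R) (a M : R) : M <= a ->
  vanishes_beyond M f -> \int[mu]_x f x = \int[mu]_(x in `[- a, a]) f x.
Proof.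
move=> Ma fM; apply: Rintegral_vanishes_beyond => x ax.
by apply: fM; exact: le_lt_trans ax.
Qed.

Notation Phi := (bump_primitive rho).

Lemma test_function_bump_primitive (m : R) : 0 < m ->
  test_function (fun x => Phi (m * x)).
Proof.
move=> m0; split; first by apply: smooth_scale; exact: (smooth_bump_primitive hr hrho).
exists (2 / m) => x; rewrite ltr_pdivrMr// => xm.
apply: (vanishes_beyond_bump_primitive hr hrho).
by rewrite normrM gtr0_norm// mulrC.
Qed.

Lemma derive1_bump_primitive (m : R) :
  derive1 (fun x => Phi (m * x)) = (fun x => m * phi (m * x)).
Proof.
apply/funext => x; rewrite derive1E.
have dm := is_derive_mulrl m x.
have := @is_derive1_comp _ Phi ( *%R m) x _ _
  (is_derive_bump_primitive hr hrho (m * x)) dm.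
by move=> ?; rewrite mulrC; exact: derive_val.
Qed.

(** [m * phi (m * x)] is the derivative of [Phi (m * x)], so the pairing moves to [V]. Since [Phi]
    is bounded and the support shrinks, absolute continuity of the integral of [|V|] finishes. *)
Lemma weak_pairing_small (e : R) : 0 < e -> exists2 m0 : R, 1 <= m0 &
  forall m, m0 <= m ->
    `|\int[mu]_(x in `[- 2, 2]) (W x * (m * phi (m * x)))| <= e.
Proof.
have [_ lV WVE] := WV; move=> e0.
have cPhi := smooth_continuous (smooth_bump_primitive hr hrho).
have vPhi := vanishes_beyond_bump_primitive hr hrho.
have [B B0 PhiB] := vanishes_beyond_bounded cPhi vPhi.
(* [V] is integrable only locally; its restriction to [[- 2, 2]] still covers every support
   [[- (2 / m), 2 / m]] with [m >= 1]. *)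
have iV : mu.-integrable setT (EFin \o (V \_ `[- 2, 2])).
  rewrite -restrict_EFin; apply/integrable_restrict => //=; rewrite setTI.
  exact: locally_integrable_itv.
have eB : 0 < e / B by rewrite divr_gt0.
have [d [d0 hd]] := integral_normr_continuous iV eB.
(* The support has length [4 / m], which is below [d] once [m > 5 / d]; the [1] secures [m >= 1]. *)
exists (1 + 5 / d) => [|m mm]; first by rewrite lerDl divr_ge0// ltW.
have m1 : 1 <= m by rewrite (le_trans _ mm)// lerDl divr_ge0// ltW.
have m0 : 0 < m by lra.
have m5 : 5 / d < m by lra.
have mi : 2 / m <= 2 by rewrite ler_pdivrMr//; lra.
have [sPhi _] := test_function_bump_primitive m0.
have v1 : vanishes_beyond (2 / m) (fun x => W x * (m * phi (m * x))).
  move=> x; rewrite ltr_pdivrMr// => xm.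
  rewrite (vanishes_beyond_odd_bump hr hrho) ?mulr0//.
  by rewrite normrM gtr0_norm// mulrC.
have v2 : vanishes_beyond (2 / m) (fun x => V x * Phi (m * x)).
  move=> x; rewrite ltr_pdivrMr// => xm.
  by rewrite vPhi ?mulr0// normrM gtr0_norm// mulrC.
rewrite -(Rintegral_supported mi v1).
have := WVE _ (test_function_bump_primitive m0).
rewrite derive1_bump_primitive => ->; rewrite normrN.
rewrite (Rintegral_vanishes_beyond v2).
have iVP : mu.-integrable `[- (2 / m), 2 / m] (EFin \o V).
  exact: locally_integrable_itv.
have iVn : mu.-integrable `[- (2 / m), 2 / m] (EFin \o (fun x => `|V x|)).
  exact: integrable_norm.
have mVP : measurable_fun `[- (2 / m), 2 / m] (fun x => V x * Phi (m * x)).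
  apply: measurable_funTS; apply: measurable_funM; first by case: lV.
  by apply: continuous_measurable_fun; exact: (smooth_continuous sPhi).
have iB : mu.-integrable `[- (2 / m), 2 / m] (EFin \o (fun x => B * `|V x|)).
  exact: integrable_EFinZl.
have VPB x : `|V x * Phi (m * x)| <= B * `|V x|.
  by rewrite normrM mulrC ler_wpM2r.
have iVPhi : mu.-integrable `[- (2 / m), 2 / m] (EFin \o (fun x => V x * Phi (m * x))).
  apply: le_integrable iB => //; first exact/measurable_EFinP.
  by move=> x _ /=; rewrite lee_fin (le_trans (VPB x))// ler_norm.
apply: le_trans (le_normr_Rintegral _ iVPhi) _ => //.
apply: (@le_trans _ _ (\int[mu]_(x in `[- (2 / m), 2 / m]) (B * `|V x|))).
  by apply: le_Rintegral => //; exact: integrable_norm.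
rewrite (@RintegralZl _ _ _ mu `[- (2 / m), 2 / m] (fun x => `|V x|))//.
rewrite -ler_pdivlMl// [B^-1 * _]mulrC.
have mA4 : (mu `[(- (2 / m))%R, (2 / m)%R] < d%:E)%E.
  rewrite lebesgue_measure_itv/= lte_fin ifT; last first.
    by rewrite (lt_trans (_ : _ < 0))// ?oppr_lt0 divr_gt0.
  rewrite -EFinD lte_fin opprK.
  have -> : 2 / m + 2 / m = 4 / m by field; lra.
  by move: m5; rewrite !ltr_pdivrMr//; nra.
have hlt := hd `[- (2 / m), 2 / m]%classic (measurable_itv _) mA4.
apply: le_trans (ltW hlt).

rewrite le_eqVlt; apply/orP; left; apply/eqP; apply: eq_Rintegral => x.
rewrite inE/= in_itv/= => /andP[h1 h2].
by rewrite patchE ifT// inE/= in_itv/=; lra.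
Qed.

Lemma Rintegral_scale_itv (f : R -> R) (m : R) : 1 <= m -> continuous f ->
  vanishes_beyond 2 f ->
  \int[mu]_(x in `[- 2, 2]) (m * f (m * x)) = \int[mu]_x f x.
Proof.
move=> m1 cf f2; have m0 : 0 < m by lra.
rewrite -(Rintegral_scale m0 cf f2); apply/esym/Rintegral_vanishes_beyond => x x2.
rewrite f2 ?mulr0// (lt_le_trans x2)// normrM gtr0_norm//.
by rewrite ler_peMl.
Qed.

Notation J0 := (\int[mu]_x (phi x ^+ 2)).
Notation J1 := (\int[mu]_x `|phi x|).

(* AM-GM once more: [|F - W| <= (lam (F - W)^2 + 1 / lam) / 2]. *)
Lemma pairing_lower (eps M1 lam q t m Y : R) : 0 <= Y -> 0 <= eps -> 1 <= m ->
  0 < lam -> t \in `[- T, 0[ -> (forall x, `|phi x| <= M1) ->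
  (forall x, 1 - r <= `|m * x| <= 1 + r ->
     `|F t x - Y * phi (m * x)| <= 3 * eps * Y) ->
  mu.-integrable `[- 2, 2] (EFin \o (fun x => (F t x - W x) ^+ 2)) ->
  \int[mu]_(x in `[- 2, 2]) ((F t x - W x) ^+ 2) <= q ->
  Y * (J0 - 3 * eps * J1) - m * M1 / 2 * (lam * q + 4 / lam) <=
  \int[mu]_(x in `[- 2, 2]) (W x * (m * phi (m * x))).
Proof.
move=> Y0 eps0 m1 lam0 tT phiM app ig gq; have m0 : 0 < m by lra.
have [lW _ _] := WV.
have M10 : 0 <= M1 by rewrite (le_trans _ (phiM 0)).
have cphi := continuous_odd_bump hrho.
have vphi := vanishes_beyond_odd_bump hr hrho.
have csq : continuous (fun x => phi x ^+ 2).
  by move=> y; rewrite /continuous_at !expr2; apply: cvgM; exact: cphi.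
have cn : continuous (fun x => `|phi x|) by move=> y; apply: cvg_norm; exact: cphi.
have cm : continuous ( *%R m) by move=> y; exact: mulrl_continuous.
have vsq : vanishes_beyond 2 (fun x => phi x ^+ 2).
  by move=> y y2; rewrite vphi// expr0n.
have vn : vanishes_beyond 2 (fun x => `|phi x|).
  by move=> y y2; rewrite vphi// normr0.
have sc f : continuous f -> continuous (fun x : R => m * f (m * x)).
  move=> cf y; apply: cvgM; first exact: cvg_cst.
  by apply: (@continuous_comp _ _ _ ( *%R m) f); [exact: cm|exact: cf].
(* The sum of [A1] to [A4] is a pointwise minorant of the integrand: [A1] and [A2] come from [F]
   being close to [Y * phi (m * x)], [A3] and [A4] from AM-GM applied to [F - W]. *)
pose A1 x := Y * (m * phi (m * x) ^+ 2).
pose A2 x := - (3 * eps * Y) * (m * `|phi (m * x)|).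
pose A3 x := - (m * M1 / 2 * lam) * (F t x - W x) ^+ 2.
pose A4 (x : R) := - (m * M1 / 2 * lam^-1).
have i1' : mu.-integrable `[- 2, 2] (EFin \o (fun x => m * phi (m * x) ^+ 2)).
  by apply: continuous_integrable_itv; exact: (sc (fun x => phi x ^+ 2)).
have i2' : mu.-integrable `[- 2, 2] (EFin \o (fun x => m * `|phi (m * x)|)).
  by apply: continuous_integrable_itv; exact: (sc (fun x => `|phi x|)).
have i1 : mu.-integrable `[- 2, 2] (EFin \o A1) by exact: integrable_EFinZl.
have i2 : mu.-integrable `[- 2, 2] (EFin \o A2) by exact: integrable_EFinZl.
have i3 : mu.-integrable `[- 2, 2] (EFin \o A3) by exact: integrable_EFinZl.
have i4 : mu.-integrable `[- 2, 2] (EFin \o A4).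
  by apply: continuous_integrable_itv => x; exact: cvg_cst.
have i12 : mu.-integrable `[- 2, 2] (EFin \o (fun x => A1 x + A2 x)).
  exact: integrable_EFinD.
have i34 : mu.-integrable `[- 2, 2] (EFin \o (fun x => A3 x + A4 x)).
  exact: integrable_EFinD.
have iW : mu.-integrable `[- 2, 2] (EFin \o W) by exact: locally_integrable_itv.
have iWn : mu.-integrable `[- 2, 2] (EFin \o (fun x => (m * M1) * `|W x|)).
  by apply: integrable_EFinZl => //; exact: integrable_norm.
have iWphi : mu.-integrable `[- 2, 2] (EFin \o (fun x => W x * (m * phi (m * x)))).
  apply: le_integrable iWn => //.
    apply/measurable_EFinP; apply: measurable_funM; first exact: measurable_funTS.
    apply: measurable_funTS; apply: continuous_measurable_fun; exact: sc.
  move=> x _ /=; rewrite lee_fin !normrM normr_id (ger0_norm M10) (gtr0_norm m0).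
  by rewrite mulrC ler_wpM2r// ler_wpM2l// ltW.
apply: (@le_trans _ _ (\int[mu]_(x in `[- 2, 2]) ((A1 x + A2 x) + (A3 x + A4 x)))).
  rewrite RintegralD//.
  rewrite (@RintegralD _ _ _ mu `[- 2, 2] A1 A2)//.
  rewrite (@RintegralD _ _ _ mu `[- 2, 2] A3 A4)//.
  rewrite (@RintegralZl _ _ _ mu `[- 2, 2] (fun x => m * phi (m * x) ^+ 2))//.
  rewrite (@RintegralZl _ _ _ mu `[- 2, 2] (fun x => m * `|phi (m * x)|))//.
  rewrite (@RintegralZl _ _ _ mu `[- 2, 2] (fun x => (F t x - W x) ^+ 2))//.
  rewrite (@Rintegral_cst _ _ _ mu `[- 2, 2] _ (- (m * M1 / 2 * lam^-1)))//.
  have -> : fine (mu `[- 2, 2]) = 4.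
    by rewrite lebesgue_measure_itv/= lte_fin ifT/= ?opprK//; lra.
  rewrite (@Rintegral_scale_itv (fun x => phi x ^+ 2))//.
  rewrite (@Rintegral_scale_itv (fun x => `|phi x|))//.
  move: gq; set G := Rintegral _ _ _ => gq.
  have : m * M1 / 2 * lam * G <= m * M1 / 2 * lam * q.
    by rewrite ler_wpM2l// !mulr_ge0// ?invr_ge0// ltW.
  move: (m * M1 / 2) => c; rewrite mulrDr; lra.
have i1234 : mu.-integrable `[- 2, 2] (EFin \o (fun x => A1 x + A2 x + (A3 x + A4 x))).
  exact: integrable_EFinD.
apply: le_Rintegral => // x _; rewrite /A1 /A2 /A3 /A4.
set y := phi (m * x); set g := F t x - W x.
(* Where [y = 0] both sides vanish; elsewhere [m * x] lies in the support ring, and the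
   approximation hypothesis is multiplied by [|y|]. *)
have Fy : Y * y ^+ 2 - 3 * eps * Y * `|y| <= F t x * y.
  have [y0|y0] := eqVneq y 0; first by rewrite y0 normr0 expr0n/= !mulr0 subrr.
  have hx : 1 - r <= `|m * x| <= 1 + r.
    apply: contraPT y0 => h; apply/negP; rewrite negbK.
    by rewrite /y (odd_bump_eq0 hr hrho).
  have := ler_wpM2r (normr_ge0 y) (app x hx).
  rewrite -normrM -/y => /ler_normlP[+ _]; rewrite mulrBl opprB; lra.
have gy : g * y <= M1 * ((lam * g ^+ 2 + lam^-1) / 2).
  apply: le_trans (ler_norm _) _; rewrite normrM mulrC.
  apply: ler_pM => //; first exact: phiM.
  have -> : g ^+ 2 = `|g| ^+ 2 by rewrite real_normK// num_real.
  have : 0 <= lam^-1 * (lam * `|g| - 1) ^+ 2 by rewrite mulr_ge0 ?sqr_ge0// invr_ge0 ltW.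
  have -> : lam^-1 * (lam * `|g| - 1) ^+ 2 = lam * `|g| ^+ 2 + lam^-1 - 2 * `|g|.
    by field; lra.
  by lra.
have := ler_wpM2l (ltW m0) (lerB Fy gy).
have -> : m * (F t x * y - g * y) = W x * (m * y) by rewrite /g; ring.
apply: le_trans.
rewrite le_eqVlt; apply/orP; left; apply/eqP.
by field; lra.
Qed.

(** Concentrated pairings with [W] tend to zero, yet each contains a bump of height at least [kap].
    The upper bound [c] on [m] is fixed before the time [t], so the [L^2] error, which the pairing
    amplifies by a factor growing with [m], can be made small. *)
Lemma no_H1_limit (eps kap : R) : 0 <= eps -> 3 * eps * J1 <= J0 / 2 -> 0 < kap ->
  (forall m0 : R, exists c : R, forall d, 0 < d -> exists t m Y : R,
    [/\ - d < t < 0, t \in `[- T, 0[, m0 <= m <= c, kap <= Y &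
      forall x, 1 - r <= `|m * x| <= 1 + r ->
        `|F t x - Y * phi (m * x)| <= 3 * eps * Y]) ->
  False.
Proof.
move=> eps0 epsJ kap0 H; have J00 := odd_bump_sq_integral_gt0 hr hrho.
set j := J0 in epsJ J00; have kj : 0 < kap * j by rewrite mulr_gt0.
have [M1 M10 phiM] := vanishes_beyond_bounded (continuous_odd_bump hrho)
  (vanishes_beyond_odd_bump hr hrho).
have [m0 m01 small] := @weak_pairing_small (kap * j / 8) (divr_gt0 kj (ltr0n _ 8)).
have [c hc] := H m0.
have c0 : 0 < c by have [//|t [m [Y [_ _ /andP[? ?] _ _]]]] := hc 1; lra.
(* With these [lam] and [q] the error terms are [kap * j / 16] and [kap * j / 32]. The pairing is
   then at least [kap * j * (1 / 2 - 3 / 32)], above the upper bound [kap * j / 8]. *)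
have [lam lam0 lamE] : exists2 lam, 0 < lam & lam = 32 * c * M1 / (kap * j).
  by eexists; last reflexivity; rewrite divr_gt0// !mulr_gt0.
have [q q0 qE] : exists2 q, 0 < q & q = kap * j / (16 * c * M1 * lam).
  by eexists; last reflexivity; rewrite divr_gt0// !mulr_gt0.
have [d d0 hd] := local_L2_cvg wom mW mF FW 2 q0.
have [t [m [Y [td tT /andP[m0m mc] kY app]]]] := hc d d0.
have [ig gq] := hd t td tT.
have m1 : 1 <= m by lra.
have Y0 : 0 <= Y by lra.
have low := pairing_lower Y0 eps0 m1 lam0 tT phiM app ig gq.
have := le_trans (le_trans low (ler_norm _)) (small m m0m).
have : kap * (j / 2) <= Y * (J0 - 3 * eps * J1).
  by apply: ler_pM => //; rewrite -/j; lra.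
have : m * M1 / 2 * (lam * q + 4 / lam) <= c * M1 / 2 * (lam * q + 4 / lam).
  apply: ler_wpM2r; first by rewrite addr_ge0 ?divr_ge0 ?mulr_ge0 ?ltW.
  by rewrite ler_wpM2r ?invr_ge0// ler_wpM2r// ltW.
have -> : c * M1 / 2 * (lam * q + 4 / lam) = kap * j * (3 / 32).
  rewrite qE lamE; field; rewrite !gt_eqF//.
lra.
Qed.

End pairing.

(** * The approximants *)

Section smooth_slices.
Context {R : realType}.
Implicit Types (E J : set R) (f : R -> R -> R).

Lemma within_continuous2 E J f :
  {within E `*` J, continuous (fun p : R * R => f p.1 p.2)} ->
  forall x t, E x -> J t -> forall e, 0 < e -> exists2 d, 0 < d &
    forall y s, E y -> J s -> `|y - x| < d -> `|s - t| < d ->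
      `|f y s - f x t| <= e.
Proof.
rewrite continuous_subspace_in => h x t Ex Jt e e0.
have : (fun p : R * R => f p.1 p.2) @ within (E `*` J) (nbhs (x, t)) --> f x t.
  by rewrite nbhs_subspace_in//; apply: (h (x, t)); rewrite inE.
move/cvgrPdist_le => /(_ e e0) /nbhs_ballP[d /= d0 hd].
exists d => // y s Ey Js yd sd; rewrite distrC; apply: (hd (y, s)) => //.
by split; rewrite /ball/= distrC.
Qed.

Lemma smooth_on_slice E J f t : smooth_on E J f -> J t -> open E ->
  forall x, E x -> [/\ derivable (f ^~ t) x 1, {for x, continuous (f ^~ t)} &
    {for x, continuous (derive1 (f ^~ t))}].
Proof.
move=> sf Jt oE x Ex.
have key (g : R -> R -> R) : {within E `*` J, continuous (fun p : R * R => g p.1 p.2)} ->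
    {for x, continuous (g ^~ t)}.
  move=> /within_continuous2 /(_ x t Ex Jt) hg; apply/cvgrPdist_le => e e0.
  have [d d0 hd] := hg e e0.
  have /nbhs_ballP[c /= c0 hc] : nbhs x E by move: oE; rewrite openE => /(_ x Ex).
  apply/nbhs_ballP; exists (Num.min c d) => [|y]; first by rewrite /= lt_min c0.
  rewrite /ball/= lt_min => /andP[yc yd]; rewrite distrC; apply: hd => //.
  - exact: hc.
  - by rewrite distrC.
  - by rewrite subrr normr0.
have [d0 [_ c0]] := sf 0%N 0%N; have [_ [_ c1]] := sf 0%N 1%N.
split; first exact: (d0 x t Ex Jt).
- exact: (key f).
- exact: (key (dx f)).
Qed.

End smooth_slices.

Section approximants.
Context {R : realType}.
Notation mu := (@lebesgue_measure R).
Variables (r : R) (rho : R -> R).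
Hypothesis hr : 0 < r <= 4^-1.
Hypothesis hrho : admissible_bump r rho.
Notation phi := (odd_bump rho).
Notation I0 := (\int[mu]_x (phi x / (- x))).

Variables (eps A T : R).
Hypothesis eps0 : 0 < eps.
Hypothesis epsI : 16 * eps <= I0.
Hypothesis A0 : 0 < A.
Hypothesis T0 : 0 < T.

Variables (n : nat) (w u : R -> R -> R) (wk : nat -> R -> R -> R)
  (xk : nat -> R -> R).
Hypothesis S : approx_solution r phi eps A T n w u wk xk.

Notation Wk k t := (fun x => rescaled r A k (xk k) (wk k) x t).

Let itvT (t : R) : t \in `[- T, 0] -> `[- T, 0]%classic t. Proof. by []. Qed.

Lemma wk_C1 k t x : (k <= n)%N -> t \in `[- T, 0] ->
  [/\ derivable (wk k ^~ t) x 1, {for x, continuous (wk k ^~ t)} &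
    {for x, continuous (derive1 (wk k ^~ t))}].
Proof.
move=> kn tT; have sk := approx_smooth_k S kn.
exact: (smooth_on_slice sk (itvT tT) openT).
Qed.

Lemma rescaled_supp k t x : (k <= n)%N -> t \in `[- T, 0] ->
  ~~ (1 - 2 * r <= `|x| <= 1 + 2 * r) -> Wk k t x = 0.
Proof. exact: (approx_supp S). Qed.

(** The difference vanishes at [0] and its derivative has [L^2] norm at most [eps], so it is at most
    [eps * (1 + |x|) / 2]. On the support ring [|x| <= 3 / 2], and off it both functions vanish. *)
Lemma rescaled_near_bump k t x : (k <= n)%N -> t \in `[- T, 0] ->
  `|Wk k t x - phi x| <= 2 * eps.
Proof.
have /andP[r0 r4] := hr; move=> kn tT.
have out y : ~~ (1 - 2 * r <= `|y| <= 1 + 2 * r) -> Wk k t y - phi y = 0.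
  move=> h; rewrite (rescaled_supp kn tT h) sub0r (odd_bump_eq0 hr hrho) ?oppr0//.
  by apply: contra h => /andP[? ?]; lra.
have out0 : Wk k t 0 - phi 0 = 0.
  by apply: out; rewrite normr0 negb_and -!ltNge; lra.
have [h|h] := boolP (1 - 2 * r <= `|x| <= 1 + 2 * r); last first.
  by rewrite out// normr0 mulr_ge0// ltW.
(* The dilation factor: the profile at [y] is [wk k (K * y) t] divided by the height [xk k t]. *)
pose K := (r / A) ^+ k * xk k t.
pose E := fun y => Wk k t y - phi y.
have sphi := smooth_odd_bump hrho.
have dE (y : R) : is_derive y 1 E
    ((xk k t)^-1 * (derive1 (wk k ^~ t) (K * y) * K) - derive1 phi y).
  have dm := is_derive_mulrl K y.
  have d1 : is_derive (K * y) 1 (wk k ^~ t) (derive1 (wk k ^~ t) (K * y)).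
    by rewrite derive1E; apply: derivableP; have [] := wk_C1 (K * y) kn tT.
  have d2 : is_derive y 1 phi (derive1 phi y).
    by rewrite derive1E; apply: derivableP; exact: (sphi 0%N).
  have d3 := @is_derive1_comp _ (wk k ^~ t) ( *%R K) y _ _ d1 dm.
  have d4 := @is_deriveZ _ _ _ _ (xk k t)^-1 _ _ _ d3.
  suff -> : E = (fun z => (xk k t)^-1 * wk k (K * z) t - phi z).
    exact: (@is_deriveB _ _ _ _ _ _ _ _ _ d4 d2).
  apply/funext => z; rewrite /E /rescaled mulrC; congr (_ * wk k _ t - _).
  by rewrite /K -mulrA mulrC.
have E'E : derive1 E = fun y =>
    (xk k t)^-1 * (derive1 (wk k ^~ t) (K * y) * K) - derive1 phi y.
  by apply/funext => y; rewrite derive1E; have := dE y => ?; exact: derive_val.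
have dE' y : derivable E y 1 by have := dE y => ?; exact: ex_derive.
have cE' : continuous (derive1 E).
  rewrite E'E => y; apply: cvgB.
    apply: cvgM; first exact: cvg_cst.
    apply: cvgM; last exact: cvg_cst.
    apply: (@continuous_comp _ _ _ ( *%R K) (derive1 (wk k ^~ t))).
      exact: mulrl_continuous.
    by have [] := wk_C1 (K * y) kn tT.
  exact/smooth_continuous/smooth_derive1.
have nE : (L2norm (derive1 E) <= eps%:E)%E by exact: (approx_H1 S).
have E0 : E 0 = 0 := out0.
have Ex : `|E x| <= eps * (1 + `|x|) / 2.
  have [x0|x0] := leP 0 x.
    have := increment_le_L2norm eps0 x0 dE' cE' nE.
    by rewrite E0 !subr0 (ger0_norm x0).
  have := increment_le_L2norm eps0 (ltW x0) dE' cE' nE.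
  by rewrite E0 !sub0r normrN (ltr0_norm x0).
apply: le_trans Ex _; have /andP[_ h2] := h.
have : eps * (1 + `|x|) <= eps * 4 by rewrite ler_pM2l//; lra.
lra.
Qed.

Lemma continuous_rescaled k t : (k <= n)%N -> t \in `[- T, 0] ->
  continuous (Wk k t).
Proof.
move=> kn tT x; apply: cvgM; last exact: cvg_cst.
have cf : {for x, continuous (fun y : R => y * (r / A) ^+ k * xk k t)}.
  by apply: cvgM; [apply: cvgM|]; [exact: cvg_id|exact: cvg_cst|exact: cvg_cst].
have [_ cw _] := wk_C1 (x * (r / A) ^+ k * xk k t) kn tT.
exact: (continuous_comp cf cw).
Qed.

Lemma rescaled_eq0 k t x : (k <= n)%N -> t \in `[- T, 0] ->
  `|x| < 2^-1 \/ 3 / 2 < `|x| -> Wk k t x = 0.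
Proof.
have /andP[r0 r4] := hr; move=> kn tT h; apply: rescaled_supp => //.
by rewrite negb_and -!ltNge; case: h => h; apply/orP; [left|right]; lra.
Qed.

(** Both profiles live on [|x| >= 2^-1], so division by [x] at most doubles the error [2 * eps].
    Over [[- 2, 2]] this sums to [16 * eps], which is at most [I0]. *)
Lemma rescaled_moment k t : (k <= n)%N -> t \in `[- T, 0] ->
  0 <= \int[mu]_x (Wk k t x / (- x)) <= 2 * I0.
Proof.
have /andP[r0 r4] := hr; move=> kn tT.
have cW := continuous_rescaled kn tT.
have cg : continuous (fun x => Wk k t x / (- x)).
  apply: (@continuous_divN _ 2^-1) => // x xh.
  by apply: rescaled_eq0 => //; left.
have vg : vanishes_beyond 2 (fun x => Wk k t x / (- x)).
  by move=> x x2; rewrite rescaled_eq0 ?mul0r//; right; lra.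
have cp := continuous_odd_bump_div hr hrho.
have vp : vanishes_beyond 2 (fun x => phi x / (- x)).
  by move=> x x2; rewrite (vanishes_beyond_odd_bump hr hrho) ?mul0r.
have ig := continuous_integrable_itv (- 2) 2 cg.
have ip := continuous_integrable_itv (- 2) 2 cp.
have ie : mu.-integrable `[- 2, 2] (EFin \o (fun _ : R => 4 * eps)).
  by apply: continuous_integrable_itv => x; exact: cvg_cst.
have near x : `|Wk k t x / (- x) - phi x / (- x)| <= 4 * eps.
  rewrite -mulrBl normrM normfV normrN.
  have [xh|xh] := ltP `|x| 2^-1.
    rewrite rescaled_eq0//; last by left.
    have -> : phi x = 0.
      by apply: (odd_bump_eq0 hr hrho); rewrite negb_and -!ltNge; lra.
    by rewrite subrr normr0 mul0r mulr_ge0// ltW.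
  have x0 : 0 < `|x| by lra.
  rewrite ler_pdivrMr//; apply: le_trans (rescaled_near_bump x kn tT) _.
  have : eps * 2^-1 <= eps * `|x| by rewrite ler_pM2l.
  lra.
have ce : \int[mu]_(x in `[- 2, 2]) (4 * eps) = 16 * eps.
  rewrite (@Rintegral_cst _ _ _ mu `[- 2, 2] _ (4 * eps))//.
  have -> : fine (mu `[- 2, 2]) = 4.
    by rewrite lebesgue_measure_itv/= lte_fin ifT/= ?opprK//; lra.
  by ring.
have u1 : \int[mu]_x (Wk k t x / (- x)) <= I0 + 16 * eps.
  rewrite (Rintegral_vanishes_beyond vg) (Rintegral_vanishes_beyond vp) -ce.
  rewrite -(@RintegralD _ _ _ mu `[- 2, 2] (fun x => phi x / (- x)) (fun=> 4 * eps))//.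
  apply: le_Rintegral => //; first exact: integrable_EFinD.
  by move=> x _; have := near x; rewrite ler_norml => /andP[? ?]; lra.
have u2 : I0 <= \int[mu]_x (Wk k t x / (- x)) + 16 * eps.
  rewrite (Rintegral_vanishes_beyond vg) (Rintegral_vanishes_beyond vp) -ce.
  rewrite -(@RintegralD _ _ _ mu `[- 2, 2] (fun x => Wk k t x / (- x)) (fun=> 4 * eps))//.
  apply: le_Rintegral => //; first exact: integrable_EFinD.
  by move=> x _; have := near x; rewrite ler_norml => /andP[? ?]; lra.
move: u1 u2 epsI; set I := I0; set J := Rintegral _ _ _ => u1 u2 eI.
by apply/andP; split; lra.
Qed.

(** Upper bound for the Hilbert transform of a rescaled profile at the origin. *)
Definition hilbert_bound : R := pi^-1 * (2 * I0).

Lemma wkE k t y : xk k t != 0 -> 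
  wk k y t = xk k t * Wk k t (((r / A) ^+ k * xk k t)^-1 * y).
Proof.
have /andP[r0 r4] := hr; move=> X0.
have rA : (r / A) ^+ k != 0 by rewrite expf_neq0// mulf_neq0 ?invr_eq0 ?gt_eqF.
rewrite /rescaled mulrC divfK//; congr wk.
by field; rewrite X0 rA.
Qed.

(** The kernel [1 / y] is homogeneous of degree [-1]: the dilation cancels against the measure and
    only the height [xk k t] multiplies the moment of the profile. *)
Lemma hilbert_wk_bounds k t : (k <= n)%N -> t \in `[- T, 0] -> 0 < xk k t ->
  0 <= hilbert (wk k ^~ t) 0 <= xk k t * hilbert_bound.
Proof.
have /andP[r0 r4] := hr; move=> kn tT X0.
set X := xk k t in X0 *.
have [P P0 PE] : exists2 P, 0 < P & P = (r / A) ^+ k * X.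
  by eexists; last reflexivity; rewrite mulr_gt0 ?exprn_gt0// divr_gt0.
have vE y : wk k y t = X * Wk k t (P^-1 * y) by rewrite PE wkE// gt_eqF.
have cg : continuous (fun x => Wk k t x / (- x)).
  apply: (@continuous_divN _ 2^-1) => // [|x xh]; first exact: continuous_rescaled.
  by apply: rescaled_eq0 => //; left.
have vg : vanishes_beyond 2 (fun x => Wk k t x / (- x)).
  by move=> x x2; rewrite rescaled_eq0 ?mul0r//; right; lra.
have fE y : wk k y t / (0 - y) =
    X * (P^-1 * (Wk k t (P^-1 * y) / (- (P^-1 * y)))).
  rewrite vE sub0r; have [->|y0] := eqVneq y 0.
    by rewrite mulr0 rescaled_eq0 ?mulr0 ?mul0r ?mulr0//; left; rewrite normr0.
  by field; rewrite y0 gt_eqF.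
have P10 : 0 < P^-1 by rewrite invr_gt0.
have ci : continuous (fun y => P^-1 * (Wk k t (P^-1 * y) / (- (P^-1 * y)))).
  move=> y; apply: cvgM; first exact: cvg_cst.
  apply: (@continuous_comp _ _ _ ( *%R P^-1) (fun x => Wk k t x / (- x))).
    exact: mulrl_continuous.
  exact: cg.
have vi : vanishes_beyond (2 * P) (fun y => P^-1 * (Wk k t (P^-1 * y) / (- (P^-1 * y)))).
  move=> y y2; have /= -> := vg (P^-1 * y); first by rewrite mulr0.
  by rewrite normrM gtr0_norm// mulrC ltr_pdivlMr.
have Iint : \int[mu]_y (wk k y t / (0 - y)) = X * \int[mu]_x (Wk k t x / (- x)).
  rewrite -(Rintegral_scale P10 cg vg) -RintegralZl//.
    by apply: eq_Rintegral => y _; exact: fE.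
  exact: vanishes_beyond_integrable ci vi.
have lE : lim (hilbert_trunc (wk k ^~ t) 0 d @[d --> 0^'+]) =
    X * \int[mu]_x (Wk k t x / (- x)).
  (* The function vanishes near the origin and far from it, so for small [d] neither cutoff removes
     anything and the truncated integral is constant. *)
  apply: lim_near_cst => //; near=> d.
  rewrite /hilbert_trunc Rintegral_mkcond -Iint; apply: eq_Rintegral => y _.
  rewrite patchE; case: ifPn => //; rewrite notin_setE /hilbert_domain/= sub0r normrN.
  move=> /negP; rewrite negb_and -!leNgt => h.
  rewrite vE rescaled_eq0 ?mulr0 ?mul0r// normrM gtr0_norm// mulrC.
  case/orP : h => h; [left|right].
    by rewrite ltr_pdivrMr// (le_lt_trans h)//; near: d; apply: nbhs_right_lt;
       rewrite mulr_gt0 ?invr_gt0.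
  rewrite ltr_pdivlMr//; apply: lt_le_trans h.
  rewrite -ltf_pV2 ?posrE ?invr_gt0// ?mulr_gt0 ?divr_gt0//.
  rewrite invrK; near: d; apply: nbhs_right_lt.
  by rewrite invr_gt0 mulr_gt0// divr_gt0.
have /andP[m0 m1] := rescaled_moment kn tT.
have pi0 : 0 < pi^-1 :> R by rewrite invr_gt0 pi_gt0.
rewrite /hilbert lE /hilbert_bound mulrCA; apply/andP; split.
  by rewrite mulr_ge0 ?(ltW X0)// mulr_ge0// ltW.
by rewrite ler_pM2l// ler_pM2l.
Unshelve. all: by end_near. Qed.

(** The exponent [C_k]: a bound for the growth rate of [x_{n,k}] that is the same for all [n]. *)
Definition growth k : R := hilbert_bound * \sum_(j < k) A ^+ j.

Lemma hilbert_bound_ge0 : 0 <= hilbert_bound.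
Proof.
rewrite /hilbert_bound mulr_ge0 ?invr_ge0 ?pi_ge0// mulr_ge0//.
exact/ltW/(odd_bump_div_integral_gt0 hr hrho).
Qed.

Lemma growth_ge0 k : 0 <= growth k.
Proof.
rewrite /growth mulr_ge0 ?hilbert_bound_ge0//.
by apply: sumr_ge0 => j _; rewrite exprn_ge0// ltW.
Qed.

(** The rate of [xk k] involves only indices [j < k]. By strong induction their heights are positive
    and at most [A ^+ j], so the rate lies between [0] and [growth k]. *)
Lemma xk_bounds k : (k <= n)%N -> forall t, t \in `[- T, 0] ->
  A ^+ k * expR (growth k * t) <= xk k t <= A ^+ k.
Proof.
elim/ltn_ind: k => k IH kn t tT.
rewrite -(approx_scale_final S kn).
apply: (linear_ode_bounds T0 (growth_ge0 k) _
  (fun s sT => approx_scale_eq S kn sT)) tT.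
- move=> {}t tT; suff hj (j : 'I_k) :
      0 <= hilbert (wk j ^~ t) 0 <= A ^+ j * hilbert_bound.
    rewrite sumr_ge0/=; last by move=> j _; have /andP[] := hj j.
    rewrite /growth mulr_sumr; apply: ler_sum => j _.
    by rewrite [leRHS]mulrC; have /andP[] := hj j.
  have jn : (j <= n)%N by rewrite (leq_trans _ kn)// ltnW.
  have /andP[x1 x2] := IH j (ltn_ord j) jn t tT.
  have x0 : 0 < xk j t by rewrite (lt_le_trans _ x1)// mulr_gt0 ?exprn_gt0 ?expR_gt0.
  have /andP[-> h2] := hilbert_wk_bounds jn tT x0.
  by rewrite (le_trans h2)// ler_wpM2r ?hilbert_bound_ge0.
- by rewrite (approx_scale_final S kn) exprn_gt0.
Qed.

Lemma xk_gt0 k t : (k <= n)%N -> t \in `[- T, 0] -> 0 < xk k t.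
Proof.
move=> kn tT; have /andP[+ _] := xk_bounds kn tT; apply: lt_le_trans.
by rewrite mulr_gt0 ?exprn_gt0 ?expR_gt0.
Qed.

Lemma xk_continuous k : (k <= n)%N -> {within `[- T, 0], continuous (xk k)}.
Proof. by move=> kn; have [] := has_deriv_within_itv (fun s sT => approx_scale_eq S kn sT). Qed.

(** The rate of [xk k.+1] exceeds that of [xk k] by the nonnegative Hilbert transform of [wk k] at
    [0], so their ratio is largest at time [0], where it equals [A]. *)
Lemma xkS_le k t : (k < n)%N -> t \in `[- T, 0] -> xk k.+1 t <= A * xk k t.
Proof.
move=> kn tT; have kn' := ltnW kn.
rewrite -ler_pdivrMr ?xk_gt0//.
have := @ratio_le _ T (xk k) (xk k.+1) _ _ T0 _ _
  (fun s sT => approx_scale_eq S kn' sT)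
  (fun s sT => approx_scale_eq S kn sT).
move=> /(_ _ _ t tT) h; apply: le_trans (h _ _) _.
- by move=> s sT; rewrite !xk_gt0.
- move=> s sT; rewrite big_ord_recr/= lerDl.
  by have /andP[] := hilbert_wk_bounds kn' sT (xk_gt0 kn' sT).
- rewrite !(approx_scale_final S)// exprS mulfK//.
  by rewrite expf_neq0// gt_eqF.
Qed.

(** The distance [p_k] of the [k]-th bump from the origin. *)
Definition scale k t : R := (r / A) ^+ k * xk k t.

Lemma scale_bounds k t : (k <= n)%N -> t \in `[- T, 0] ->
  r ^+ k * expR (growth k * t) <= scale k t <= r ^+ k.
Proof.
have /andP[r0 r4] := hr; move=> kn tT; have /andP[h1 h2] := xk_bounds kn tT.
have rA : 0 < (r / A) ^+ k by rewrite exprn_gt0// divr_gt0.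
have E : r ^+ k = (r / A) ^+ k * A ^+ k.
  by rewrite -exprMn divfK// gt_eqF.
by rewrite /scale E -mulrA !ler_pM2l// h1.
Qed.

Lemma scale_gt0 k t : (k <= n)%N -> t \in `[- T, 0] -> 0 < scale k t.
Proof.
have /andP[r0 r4] := hr; move=> kn tT.
by rewrite mulr_gt0 ?xk_gt0// exprn_gt0// divr_gt0.
Qed.

Lemma scale_le j k t : (j < k)%N -> (k <= n)%N -> t \in `[- T, 0] ->
  scale k t <= r * scale j t.
Proof.
have /andP[r0 r4] := hr; move=> jk kn tT.
have step i : (i < n)%N -> scale i.+1 t <= r * scale i t.
  move=> ni; have h := xkS_le ni tT.
  have -> : r * scale i t = (r / A) ^+ i.+1 * (A * xk i t).
    by rewrite /scale exprS; field; rewrite gt_eqF.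
  by rewrite /scale ler_pM2l// exprn_gt0// divr_gt0.
elim: k jk kn => [//|k IH]; rewrite ltnS leq_eqVlt => /predU1P[->|jk] kn.
  exact: step.
apply: le_trans (step k kn) _; rewrite ler_pM2l//.
apply: le_trans (IH jk (ltnW kn)) _.
by rewrite ler_piMl ?(ltW (scale_gt0 _ _))// ?(leq_trans (ltnW jk))// ?(ltnW kn)//; lra.
Qed.

Lemma wk_eq0 k t y : (k <= n)%N -> t \in `[- T, 0] ->
  `|y| < (1 - 2 * r) * scale k t \/ (1 + 2 * r) * scale k t < `|y| ->
  wk k y t = 0.
Proof.
move=> kn tT h; have p0 := scale_gt0 kn tT.
rewrite wkE; last by rewrite gt_eqF ?xk_gt0.
rewrite rescaled_supp ?mulr0// -/(scale k t) normrM gtr0_norm ?invr_gt0//.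
rewrite [_^-1 * _]mulrC negb_and -!ltNge ltr_pdivrMr// ltr_pdivlMr//.
by case: h => ->; rewrite ?orbT.
Qed.

(** The first bound puts [y] beyond the outer edge of every bump of larger index, the second before
    the inner edge of every bump of smaller index. *)
Lemma isolated k t y : (k <= n)%N -> t \in `[- T, 0] ->
  r * (1 + 2 * r) * scale k t < `|y| -> r * `|y| < (1 - 2 * r) * scale k t ->
  w y t = wk k y t.
Proof.
have /andP[r0 r4] := hr; move=> kn tT h1 h2.
rewrite (approx_sum S)// (bigD1 (Ordinal (kn : (k < n.+1)%N)))//= big1 ?addr0//.
move=> j /negPf jk; have jn : (j <= n)%N by rewrite -ltnS.
have {}jk : (j : nat) != k by apply/negP => /eqP e; move/negP: jk; apply; apply/eqP/val_inj.
apply: wk_eq0 => //; move: jk; rewrite neq_ltn => /orP[jk|jk].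
- left; rewrite -(ltr_pM2l r0); apply: lt_le_trans h2 _.
  by rewrite [leRHS]mulrCA ler_pM2l; [exact: scale_le|lra].
- right; apply: le_lt_trans h1.
  by rewrite [r * _]mulrC -mulrA ler_pM2l; [exact: scale_le|lra].
Qed.

Lemma gap_eq0 k t z : (k <= n)%N -> t \in `[- T, 0] ->
  r * (1 + 2 * r) < `|z| < 1 - 2 * r -> w (scale k t * z) t = 0.
Proof.
have /andP[r0 r4] := hr; move=> kn tT /andP[z1 z2]; have p0 := scale_gt0 kn tT.
have nE : `|scale k t * z| = `|z| * scale k t.
  by rewrite normrM gtr0_norm// mulrC.
rewrite (isolated kn tT) ?nE.
- by apply: wk_eq0 => //; left; rewrite nE ltr_pM2r.
- by rewrite ltr_pM2r.
- by rewrite mulrA ltr_pM2r//; nra.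
Qed.

(** Since [r <= 4^-1], the support ring of [phi] lies inside the window where the [k]-th bump is
    isolated. *)
Lemma near_bump k t z : (k <= n)%N -> t \in `[- T, 0] ->
  1 - r <= `|z| <= 1 + r ->
  `|w (scale k t * z) t - xk k t * phi z| <= 2 * eps * xk k t.
Proof.
have /andP[r0 r4] := hr; move=> kn tT /andP[z1 z2]; have p0 := scale_gt0 kn tT.
have X0 := xk_gt0 kn tT.
have nE : `|scale k t * z| = `|z| * scale k t.
  by rewrite normrM gtr0_norm// mulrC.
rewrite (isolated kn tT) ?nE.
- rewrite wkE ?gt_eqF// -/(scale k t) mulKf ?gt_eqF// -mulrBr normrM gtr0_norm//.
  by rewrite mulrC ler_pM2r//; exact: rescaled_near_bump.
- by rewrite ltr_pM2r//; nra.
- by rewrite mulrA ltr_pM2r//; nra.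
Qed.

Lemma far_eq0 t y : t \in `[- T, 0] -> 1 + 2 * r < `|y| -> w y t = 0.
Proof.
have /andP[r0 r4] := hr; move=> tT hy; rewrite (approx_sum S)// big1// => j _.
have jn : (j <= n)%N by rewrite -ltnS.
apply: wk_eq0 => //; right; apply: le_lt_trans hy.
rewrite ler_piMr//; first lra.
have /andP[_ /le_trans] := scale_bounds jn tT; apply.
by rewrite exprn_ile1//; lra.
Qed.

(** Bumps of index at least [N] end before [(1 + 2 * r) * r ^+ N], so at most [N] terms survive,
    each bounded through its height. *)
Lemma bounded_away (N : nat) (M1 : R) t y : 1 <= A -> (forall x, `|phi x| <= M1) ->
  t \in `[- T, 0] -> (1 + 2 * r) * r ^+ N < `|y| ->
  `|w y t| <= (A ^+ N * (M1 + 2 * eps)) * N%:R.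
Proof.
have /andP[r0 r4] := hr; move=> A1 phiM tT hy; rewrite (approx_sum S)//.
have M10 : 0 <= M1 by rewrite (le_trans _ (phiM 0)).
set c := A ^+ N * _; have c0 : 0 <= c.
  by rewrite mulr_ge0 ?exprn_ge0 ?addr_ge0 ?mulr_ge0// ltW.
apply: (@le_trans _ _ (\sum_(k < n.+1) if (k < N)%N then c else 0)).
  apply: le_trans (ler_norm_sum _ _ _) _; apply: ler_sum => j _.
  have jn : (j <= n)%N by rewrite -ltnS.
  have X0 := xk_gt0 jn tT; have /andP[_ XA] := xk_bounds jn tT.
  case: ltnP => jN.
    rewrite wkE ?gt_eqF// normrM gtr0_norm//; apply: ler_pM => //; first exact: ltW.
      by apply: le_trans XA _; rewrite ler_weXn2l// ltnW.
    set z := _ * y; have := rescaled_near_bump z jn tT; have := phiM z.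
    move=> h1 h2; rewrite -[rescaled _ _ _ _ _ _ _](subrK (phi z)).
    by rewrite (le_trans (ler_normD _ _))// addrC lerD.
  rewrite wk_eq0 ?normr0//; right; apply: le_lt_trans hy.
  rewrite ler_pM2l; last lra.
  have /andP[_ /le_trans] := scale_bounds jn tT; apply.
  by rewrite ler_wiXn2l//; lra.
suff -> : \sum_(k < n.+1) (if (k < N)%N then c else 0) = c * (minn n.+1 N)%:R.
  by rewrite ler_wpM2l// ler_nat geq_minr.
elim: (n.+1) => [|k IH]; first by rewrite big_ord0 min0n mulr0.
have [kN|kN] := ltnP k N; rewrite big_ord_recr IH.
  by rewrite (minn_idPl (ltnW kN)) (minn_idPl kN)/= kN -natr1 mulrDr mulr1.
by rewrite (minn_idPr kN) (minn_idPr (leqW kN))/= ltnNge kN addr0.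
Qed.

End approximants.

(** * The limit solution *)

Section limit_solution.
Context {R : realType}.
Notation mu := (@lebesgue_measure R).
Variables (r : R) (rho : R -> R).
Hypothesis hr : 0 < r <= 4^-1.
Hypothesis hrho : admissible_bump r rho.
Notation phi := (odd_bump rho).
Notation I0 := (\int[mu]_x (phi x / (- x))).

Variables (eps A T : R).
Hypothesis eps0 : 0 < eps.
Hypothesis epsI : 16 * eps <= I0.
Hypothesis A1 : 1 < A.
Hypothesis T0 : 0 < T.

Variables (wn un : nat -> R -> R -> R) (wnk : nat -> nat -> R -> R -> R)
  (xnk : nat -> nat -> R -> R) (sigma : nat -> nat) (w : R -> R -> R).
Hypothesis app : forall n,
  approx_solution r phi eps A T n (wn n) (un n) (wnk n) (xnk n).
Hypothesis sigma_incr : forall m m', (m < m')%N -> (sigma m < sigma m')%N.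
Hypothesis cv : converges_to T (fun m => wn (sigma m)) w.

Let A0 : 0 < A. Proof. by move: A1; lra. Qed.

Lemma sigma_ge m : (m <= sigma m)%N.
Proof. by elim: m => // m IH; apply: leq_ltn_trans IH _; exact: sigma_incr. Qed.

Lemma itvcoW (t : R) : t \in `[- T, 0[ -> t \in `[- T, 0].
Proof. by rewrite !in_itv/= => /andP[-> /ltW ->]. Qed.

Lemma uniform_away (a b s e : R) : 0 < a -> s < 0 -> 0 < e -> exists N : nat,
  forall m x t, (N <= m)%N -> a <= `|x| <= b -> t \in `[- T, s] ->
    `|wn (sigma m) x t - w x t| <= e.
Proof.
move=> a0 s0 e0; have [_ _ ucv] := cv.
pose K : set R := `[- b, - a] `|` `[a, b].
have cK : compact K by apply: compactU; exact: segment_compact.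
have K0 : ~ K 0 by case; rewrite /= in_itv/= => /andP[? ?]; lra.
have [N _ hN] := ucv 0%N 0%N K s e cK K0 s0 e0.
exists N => m x t Nm xab tT; apply: (hN m Nm x t) => //.
move: xab => /andP[]; rewrite /K /= !in_itv/=.
have [x0|x0] := leP 0 x.
  by rewrite ger0_norm// => -> ->; right.
by rewrite ltr0_norm// => ? ?; left; apply/andP; split; lra.
Qed.

Lemma pointwise_limit (k : nat) x t (e : R) : x != 0 -> t \in `[- T, 0[ -> 0 < e ->
  exists m, (k <= sigma m)%N /\ `|wn (sigma m) x t - w x t| <= e.
Proof.
move=> x0 tT e0; have t0 : t < 0 by move: tT; rewrite in_itv/= => /andP[].
have x0' : 0 < `|x| by rewrite normr_gt0.
have [N hN] := @uniform_away `|x| `|x| t e x0' t0 e0.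
exists (maxn N k); split.
  by apply: leq_trans (sigma_ge _); exact: leq_maxr.
apply: hN; first exact: leq_maxl.
  by rewrite lexx.
by move: tT; rewrite !in_itv/= lexx => /andP[->].
Qed.

Lemma limit_le (B : R) x t : x != 0 -> t \in `[- T, 0[ ->
  (forall n, `|wn n x t| <= B) -> `|w x t| <= B.
Proof.
move=> x0 tT hB; apply/ler_addgt0Pr => e e0.
have [m [_ hm]] := pointwise_limit 0 x0 tT e0.
rewrite -[w x t](subrK (wn (sigma m) x t)) addrC.
by rewrite (le_trans (ler_normD _ _))// lerD// distrC.
Qed.

Lemma limit_far_eq0 t y : t \in `[- T, 0[ -> 1 + 2 * r < `|y| -> w y t = 0.
Proof.
have /andP[r0 r4] := hr; move=> tT hy; apply/eqP; rewrite -normr_le0.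
apply: limit_le => // [|n]; first by rewrite -normr_gt0; lra.
by rewrite (far_eq0 hr hrho eps0 epsI A0 T0 (app n) (itvcoW tT) hy) normr0.
Qed.

Lemma limit_bounded_away (d : R) : 0 < d -> exists2 B, 0 < B &
  forall t y, t \in `[- T, 0[ -> d <= `|y| -> `|w y t| <= B.
Proof.
have /andP[r0 r4] := hr; move=> d0.
have [M1 M10 phiM] := vanishes_beyond_bounded (continuous_odd_bump hrho)
  (vanishes_beyond_odd_bump hr hrho).
have [N hN] : exists N, (1 + 2 * r) * r ^+ N < d.
  have : (1 + 2 * r) * r ^+ n @[n --> \oo] --> (1 + 2 * r) * 0.
    by apply: cvgMl_tmp; apply: cvg_expr; rewrite ger0_norm; lra.
  rewrite mulr0 => /cvgrPdist_lt /(_ d d0)[N _ hN].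
  exists N; have := hN N (leqnn N); rewrite sub0r normrN.
  by apply: le_lt_trans; exact: ler_norm.
(* The summand [1] keeps the bound positive when [N = 0]. *)
exists ((A ^+ N * (M1 + 2 * eps)) * N%:R + 1).
  by rewrite ltr_wpDl// !mulr_ge0 ?exprn_ge0 ?addr_ge0 ?mulr_ge0// ltW.
move=> t y tT dy; apply: (@le_trans _ _ ((A ^+ N * (M1 + 2 * eps)) * N%:R)); last first.
  by rewrite lerDl.
apply: limit_le => // [|n]; first by rewrite -normr_gt0; lra.
apply: (bounded_away hr hrho eps0 epsI A0 T0 (app n) (ltW A1) phiM (itvcoW tT)).
exact: lt_le_trans dy.
Qed.

Notation growth k := (growth rho A k).

(** One late approximant supplies [p] and [X]. Its own error is [2 * eps * X]; convergence costs
    another [eps * X], which is possible because [X] has a lower bound independent of the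
    approximant. *)
Lemma limit_near_bump k t : t \in `[- T, 0[ -> exists p X : R,
  [/\ r ^+ k * expR (growth k * t) <= p <= r ^+ k,
      A ^+ k * expR (growth k * t) <= X &
      forall z, 1 - r <= `|z| <= 1 + r ->
        `|w (p * z) t - X * phi z| <= 3 * eps * X].
Proof.
have /andP[r0 r4] := hr; move=> tT; have tT' := itvcoW tT.
have t0 : t < 0 by move: tT; rewrite in_itv/= => /andP[].
set g := expR (growth k * t); have g0 : 0 < g by exact: expR_gt0.
have a0 : 0 < (1 - r) * (r ^+ k * g) by rewrite !mulr_gt0 ?exprn_gt0//; lra.
have e0 : 0 < eps * (A ^+ k * g) by rewrite !mulr_gt0 ?exprn_gt0.
(* The position [p] depends on the approximant, so the annulus is taken large enough to contain
   [p * z] for every admissible [p]. *)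
have [N hN] := @uniform_away _ ((1 + r) * r ^+ k) t _ a0 t0 e0.
pose m := maxn N k.
have kn : (k <= sigma m)%N by rewrite (leq_trans _ (sigma_ge _))// leq_maxr.
have := scale_bounds hr hrho eps0 epsI A0 T0 (app (sigma m)) kn tT'.
have p0 := scale_gt0 hr hrho eps0 epsI A0 T0 (app (sigma m)) kn tT'.
have nb := near_bump hr hrho eps0 epsI A0 T0 (app (sigma m)) kn tT'.
have := xk_bounds hr hrho eps0 epsI A0 T0 (app (sigma m)) kn tT'.
move: nb p0; rewrite -/g; set p := scale _ _ _ _ _; set X := xnk _ _ _.
move=> nb p0 /andP[X1 _] /andP[p1 p2].
exists p, X; split => //; first by rewrite p1.
move=> z /andP[z1 z2]; have h1 := nb z; rewrite z1 z2 in h1.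
have h2 : `|wn (sigma m) (p * z) t - w (p * z) t| <= eps * (A ^+ k * g).
  apply: hN; first exact: leq_maxl.
    rewrite normrM gtr0_norm// ![p * _]mulrC; apply/andP; split; apply: ler_pM => //.
    - by lra.
    - by rewrite mulr_ge0 ?exprn_ge0 ?ltW.
    - exact: ltW.
  by move: tT; rewrite !in_itv/= lexx => /andP[->].
have h3 : eps * (A ^+ k * g) <= eps * X by rewrite ler_pM2l.
rewrite distrC in h2.
have := le_trans (ler_normD _ _) (lerD (h1 isT) (le_trans h2 h3)).
rewrite addrC addrA subrK => h4; apply: le_trans h4 _.
by lra.
Qed.

(** Convergence gives continuity only off the origin; the origin is added as a measurable
    singleton. *)
Lemma measurable_limit t : t \in `[- T, 0[ -> measurable_fun setT (w ^~ t).
Proof.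
move=> tT; have [sw _ _] := cv.
pose E : set R := [set x | x != 0].
have oE : open E.
  rewrite (_ : E = ~` [set 0]); last by apply/seteqP; split => x /= /eqP.
  by rewrite openC; exact: closed_eq.
have -> : [set: R] = E `|` [set 0].
  apply/seteqP; split => x //= _; rewrite /E/=.
  by have [->|?] := eqVneq x 0; [right|left].
apply/measurable_funU => //; first exact: open_measurable.
split; last exact: measurable_fun_set1.
apply: open_continuous_measurable_fun => // x; rewrite inE => Ex.
by have [_ c _] := smooth_on_slice sw tT oE Ex.
Qed.

(* The crossing times depend on the approximant; compactness of the time
   interval yields one for the limit. *)
Lemma limit_gap (k : nat) (q : R -> R) (t0 t1 : R) :
  - T <= t0 -> t0 <= t1 -> t1 < 0 ->
  {within `[t0, t1], continuous q} -> (forall t, t \in `[t0, t1] -> 0 < q t) ->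
  r ^+ k < q t0 -> q t1 < r ^+ k * expR (growth k * - T) ->
  exists2 t, t \in `[t0, t1] &
    forall z, r * (1 + 2 * r) < `|z| < 1 - 2 * r -> w (q t * z) t = 0.
Proof.
have /andP[r0 r4] := hr; move=> Tt0 t01 t10 cq q0 qt0 qt1.
have subT s : s \in `[t0, t1] -> s \in `[- T, 0[.
  by rewrite !in_itv/= => /andP[? ?]; apply/andP; split; lra.
have cross m : exists t, t \in `[t0, t1] /\ ((k <= sigma m)%N ->
    forall z, r * (1 + 2 * r) < `|z| < 1 - 2 * r -> wn (sigma m) (q t * z) t = 0).
  (* When [sigma m < k] the approximant has no [k]-th bump; the claim is vacuous and [t0] is a
     default value. *)
  have [km|km] := leqP k (sigma m); last first.
    by exists t0; split => //; rewrite in_itv/= lexx.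
  have Am := app (sigma m).
  have gap := gap_eq0 hr hrho eps0 epsI A0 T0 Am km.
  have bds := scale_bounds hr hrho eps0 epsI A0 T0 Am km.
  have cx := xk_continuous Am km.
  pose p t := scale r A (xnk (sigma m)) k t.
  have cp : {within `[t0, t1], continuous p}.
    have : {within `[t0, t1], continuous (xnk (sigma m) k)}.
      apply: continuous_subspaceW cx => s /= sT; exact: (itvcoW (subT s sT)).
    by move=> h s; apply: cvgM; [exact: cvg_cst|exact: h].
  have cf : {within `[t0, t1], continuous (fun t => q t - p t)}.
    by move=> s; apply: cvgB; [exact: cq|exact: cp].
  have i0 : t0 \in `[t0, t1] by rewrite in_itv/= lexx.
  have i1 : t1 \in `[t0, t1] by rewrite in_itv/= lexx andbT.
  have /andP[_ b0] := bds t0 (itvcoW (subT _ i0)).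
  have /andP[b1 _] := bds t1 (itvcoW (subT _ i1)).
  have f0 : 0 <= q t0 - p t0 by rewrite subr_ge0 (le_trans b0)// ltW.
  have f1 : q t1 - p t1 <= 0.
    rewrite subr_le0 (le_trans (ltW qt1))// (le_trans _ b1)//.
    rewrite ler_pM2l ?exprn_gt0// ler_expR ler_wpM2l ?(growth_ge0 hr hrho A0)//.
    by lra.
  (* [q] starts above [r ^+ k], hence above [p], and ends below the least value [p] can take. Where
     they meet, the gap of the approximant sits at [q t]. *)
  have [|t tT ft] := @IVT _ _ _ _ 0 t01 cf.
    by rewrite ge_min f1 orbT le_max f0.
  exists t; split => // _ z hz.
  have -> : q t = p t by apply/eqP; rewrite -subr_eq0 ft.
  by apply: gap => //; exact/itvcoW/subT.
have [tau htau] := choice cross.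
have [] := @segment_compact R t0 t1 (tau @ \oo).
  by exists 0%N => // m _; have [] := htau m.
move=> t [tT clt]; exists t => // z hz; apply: contrapT => /eqP wz.
have z0 : 0 < `|z| by case/andP: hz => + _; apply: lt_trans; rewrite mulr_gt0//; lra.
set v := `|w (q t * z) t|; have v0 : 0 < v by rewrite normr_gt0.
have qt := q0 t tT.
have [sw _ _] := cv; have [_ [_ cw]] := sw 0%N 0%N.
have nz s : s \in `[t0, t1] -> q s * z != 0.
  by move=> sT; rewrite mulf_neq0//; [rewrite gt_eqF// q0|rewrite -normr_gt0].
have v4 : 0 < v / 4 by rewrite divr_gt0.
have [d d0 hd] := within_continuous2 cw (nz t tT) (subT t tT) v4.
(* The first entry keeps [q s * z] within [d] of [q t * z]; the second keeps [q s] between [q t / 2]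
   and [2 * q t], so that all points stay in one annulus. *)
have e0 : 0 < Num.min (d / 2 / `|z|) (q t / 2).
  by rewrite lt_min !divr_gt0.
have [c c0 hc] := (within_continuousP _ _).1 cq t tT _ e0.
have a0 : 0 < q t / 2 * `|z| by rewrite mulr_gt0// divr_gt0.
have [N hN] := @uniform_away _ (2 * q t * `|z|) t1 _ a0 t10 v4.
have Ftau : (tau @ \oo) [set tau m | m in [set m | (maxn N k <= m)%N]].
  by exists (maxn N k) => // m /= Nm; exists m.
have nbt : nbhs t [set s | `|s - t| < Num.min c d].
  apply/nbhs_ballP; exists (Num.min c d); first by rewrite /= lt_min c0.
  by move=> s; rewrite /ball/= distrC.
have [s [[m /= Nm <-] /= sB]] := clt _ _ Ftau nbt.
have [sT hz0] := htau m; move: sB; rewrite lt_min => /andP[sc sd].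
have km : (k <= sigma m)%N.
  by rewrite (leq_trans _ (sigma_ge m))// (leq_trans _ Nm)// leq_maxr.
have wz0 := hz0 km z hz.
have := hc (tau m) sT sc; rewrite le_min => /andP[q1 q2].
have h1 : `|w (q (tau m) * z) (tau m) - w (q t * z) t| <= v / 4.
  apply: hd => //; [exact: nz|exact: subT|].
  rewrite -mulrBl normrM -ltr_pdivlMr// (le_lt_trans q1)//.
  by rewrite ltr_pM2r ?invr_gt0//; lra.
have h2 : `|wn (sigma m) (q (tau m) * z) (tau m) - w (q (tau m) * z) (tau m)| <= v / 4.
  apply: hN; first by rewrite (leq_trans _ Nm)// leq_maxl.
    rewrite normrM (gtr0_norm (q0 _ sT)) !ler_pM2r//.
    by move: q2; rewrite ler_norml => /andP[? ?]; apply/andP; split; lra.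
  by move: sT; rewrite !in_itv/= => /andP[? ->]; rewrite andbT; lra.
rewrite wz0 sub0r normrN in h2.
(* The approximant vanishes at the crossing, so two errors of [v / 4] would have to make up the
   whole of [v]. *)
have := ler_normB (w (q (tau m) * z) (tau m)) (w (q (tau m) * z) (tau m) - w (q t * z) t).
rewrite opprB addrC subrK -/v; lra.
Qed.

End limit_solution.

(** * Vanishing almost everywhere from countable covers *)

Section ae_cover.
Context {R : realType}.
Notation mu := (@lebesgue_measure R).

Lemma ae_eq0_cover (W : R -> R) (E : (set R)^nat) :
  (forall n, {ae mu, forall x, E n x -> W x = 0}) ->
  (forall x, x != 0 -> exists n, E n x) -> {ae mu, forall x, W x = 0}.
Proof.
move=> E0 cE.
have n0 : mu.-negligible [set (0 : R)].
  by apply/negligibleP => //; exact: lebesgue_measure_set1.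
have nE : mu.-negligible (\bigcup_n ~` [set x | E n x -> W x = 0]).
  by apply: negligible_bigcup => n; exact: E0.
apply: (negligibleS _ (negligibleU n0 nE)) => x /= Wx.
have [->|x0] := eqVneq x 0; first by left.
by right; have [n Enx] := cE x x0; exists n => //= /(_ Enx).
Qed.

Lemma measurable_annulus (q a b : R) :
  measurable [set x : R | a < q * `|x| < b].
Proof.
apply: open_measurable.
have c : continuous (fun x : R => q * `|x|).
  by move=> x; apply: cvgM; [exact: cvg_cst|exact: norm_continuous].
have -> : [set x : R | a < q * `|x| < b] = (fun x : R => q * `|x|) @^-1` `]a, b[.
  by apply/seteqP; split => x /=; rewrite in_itv.
by apply: open_comp => [x _|]; [exact: c|exact: itv_open].
Qed.

End ae_cover.

(** * The possible behaviours of the scaling factors *)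

Section not_self_similar.
Context {R : realType}.
Notation mu := (@lebesgue_measure R).
Variables (r : R) (rho : R -> R).
Hypothesis hr : 0 < r <= 4^-1.
Hypothesis hrho : admissible_bump r rho.
Notation phi := (odd_bump rho).

Variables (eps A T : R).
Hypothesis eps0 : 0 < eps.
Hypothesis epsI : 16 * eps <= \int[mu]_x (phi x / (- x)).
Hypothesis epsJ : 3 * eps * \int[mu]_x `|phi x| <= \int[mu]_x (phi x ^+ 2) / 2.
Hypothesis A1 : 1 < A.
Hypothesis T0 : 0 < T.

Variables (wn un : nat -> R -> R -> R) (wnk : nat -> nat -> R -> R -> R)
  (xnk : nat -> nat -> R -> R) (sigma : nat -> nat) (w : R -> R -> R).
Hypothesis app : forall n,
  approx_solution r phi eps A T n (wn n) (un n) (wnk n) (xnk n).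
Hypothesis sigma_incr : forall m m', (m < m')%N -> (sigma m < sigma m')%N.
Hypothesis cv : converges_to T (fun m => wn (sigma m)) w.

Variables (W V om C_w C_l : R -> R).
Hypothesis mW : measurable_fun setT W.
Hypothesis WV : weak_derivative W V.
Hypothesis Cpos : forall t : R, t \in `[- T, 0[ -> 0 < C_w t /\ 0 < C_l t.
Hypothesis cC : {within `[- T, 0[, continuous C_l}.
Hypothesis wom : weight om.
Hypothesis FW : weighted_L2sq om (fun x => C_w t * w (C_l t * x) t - W x)
  @[t --> 0^'-] --> 0%E.

Let F t x := C_w t * w (C_l t * x) t.

Let mF t : t \in `[- T, 0[ -> measurable_fun setT (F t).
Proof.
move=> tT; apply: measurable_funM => //.
have := measurable_limit cv tT => mw.
apply: (measurableT_comp mw).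
apply: continuous_measurable_fun => x; exact: mulrl_continuous.
Qed.

Let limit_eq0 := limit_ae_eq0 wom mW mF FW.

Let A0 : 0 < A. Proof. by move: A1; lra. Qed.

Notation growth k := (growth rho A k).

Lemma ae_eq0_of_shrinking :
  (forall e, 0 < e -> exists2 d, 0 < d & forall t, - d < t < 0 ->
     t \in `[- T, 0[ -> C_l t < e) ->
  {ae mu, forall x, W x = 0}.
Proof.
have /andP[r0 r4] := hr; move=> small.
have g0 : 0 < r * (1 + 2 * r) by rewrite mulr_gt0//; lra.
(* The dilations [s] are taken rational, so that countably many rings cover the punctured line;
   codes of no rational give the empty set. *)
pose E n := if (unpickle n : option rat) is Some q then
  [set x : R | 0 < ratr q :> R /\ r * (1 + 2 * r) < ratr q * `|x| < 1 - 2 * r] else set0.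
apply: (@ae_eq0_cover _ _ E); last first.
  move=> x; rewrite -normr_gt0 => x0.
  have [|q] := @rat_in_itvoo R (r * (1 + 2 * r) / `|x|) ((1 - 2 * r) / `|x|).
    by rewrite ltr_pM2r ?invr_gt0//; nra.
  rewrite in_itv/= ltr_pdivrMr// ltr_pdivlMr// => /andP[q1 q2].
  exists (pickle q); rewrite /E pickleK; split; last by rewrite q1.
  by move: (lt_trans g0 q1); rewrite pmulr_lgt0.
move=> n; rewrite /E; case: unpickle => [q|]; last first.
  by apply: nearW => x [].
have [q0|q0] := ltP 0 (ratr q : R); last by apply: nearW => x [].
suff h : {ae mu, forall x,
    [set x : R | r * (1 + 2 * r) < ratr q * `|x| < 1 - 2 * r] x -> W x = 0}.
  by apply: negligibleS h => x /= nx hx; apply: nx => -[_ /hx].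
set p : R := ratr q in q0 *.
have ip : 0 < p^-1 by rewrite invr_gt0.
apply: (limit_eq0 ip); first exact: measurable_annulus.
  move=> x /andP[_ h]; rewrite -(ler_pM2l q0) mulfV ?gt_eqF//; lra.
move=> d e d0 e0.
have [t0 [t0d t00 t0T]] : exists t0, [/\ - d < t0, t0 < 0 & - T <= t0].
  exists (Num.max (- d / 2) (- T)); split.
  - by rewrite lt_max; apply/orP; left; lra.
  - by rewrite gt_max oppr_lt0 T0 andbT; lra.
  - by rewrite le_max lexx orbT.
have t0T' : t0 \in `[- T, 0[ by rewrite in_itv/= t0T.
pose Q t := C_l t / p.
have Qpos t : t \in `[- T, 0[ -> 0 < Q t.
  by move=> tT; rewrite divr_gt0//; have [] := Cpos tT.
(* The chosen bump starts closer to the origin than [Q t0], so that [Q], which tends to [0], has to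
   cross its position after [t0]. *)
have [k hk] : exists k, r ^+ k < Q t0.
  have : r ^+ k @[k --> \oo] --> 0 by apply: cvg_expr; rewrite ger0_norm; lra.
  move=> /cvgrPdist_lt /(_ _ (Qpos t0 t0T'))[N _ hN].
  exists N; have := hN N (leqnn N); rewrite sub0r normrN.
  by apply: le_lt_trans; exact: ler_norm.
(* The least distance from the origin that the [k]-th bump can have at any time, in any
   approximant. *)
set lo := r ^+ k * expR (growth k * - T).
have lo0 : 0 < lo by rewrite mulr_gt0 ?exprn_gt0 ?expR_gt0.
have [d1 d10 hd1] := small (lo * p) (mulr_gt0 lo0 q0).
pose t1 := Num.max t0 (- d1 / 2).
have t01 : t0 <= t1 by rewrite le_max lexx.
have t10 : t1 < 0 by rewrite gt_max t00/=; lra.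
have t1d : - d1 < t1 by rewrite lt_max; apply/orP; right; lra.
have t1T : t1 \in `[- T, 0[ by rewrite in_itv/= t10 (le_trans t0T).
have subT s : s \in `[t0, t1] -> s \in `[- T, 0[.
  by rewrite !in_itv/= => /andP[? ?]; apply/andP; split; lra.
have cQ : {within `[t0, t1], continuous Q}.
  have c0 : {within `[t0, t1], continuous C_l} by apply: continuous_subspaceW cC.
  by move=> s; apply: cvgM; [exact: c0|exact: cvg_cst].
have Qt1 : Q t1 < lo.
  by rewrite /Q ltr_pdivrMr//; apply: hd1 => //; rewrite t1d.
have [t tt hz] := limit_gap hr hrho eps0 epsI A1 T0 app sigma_incr cv t0T t01 t10 cQ
  (fun s sT => Qpos s (subT s sT)) hk Qt1.
exists t; split; [|exact: subT|].
  by move: tt; rewrite in_itv/= => /andP[? ?]; apply/andP; split; lra.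
move=> x hx; rewrite /F.
have -> : C_l t * x = Q t * (p * x).
  by rewrite /Q mulrA divfK// gt_eqF.
by rewrite hz ?mulr0 ?normr0 ?ltW// normrM gtr0_norm.
Qed.

Let E0 (n : nat) : set R := [set x | n.+1%:R^-1 <= `|x| <= n.+1%:R].

Let E0_cover x : x != 0 -> exists n, E0 n x.
Proof.
rewrite -normr_gt0 => x0.
have [n hn] : exists n : nat, Num.max `|x| (`|x|^-1) < n.+1%:R.
  by exists (Num.truncn (Num.max `|x| (`|x|^-1))); exact: truncnS_gt.
exists n; move: hn; rewrite gt_max => /andP[h1 h2]; rewrite /E0/= (ltW h1) andbT.
by rewrite -[leRHS]invrK lef_pV2 ?posrE ?invr_gt0// ltW.
Qed.

Let ae_eq0_of_E0 : (forall n (d e : R), 0 < d -> 0 < e -> exists t : R,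
    [/\ - d < t < 0, t \in `[- T, 0[ & forall x, E0 n x -> `|F t x| <= e]) ->
  {ae mu, forall x, W x = 0}.
Proof.
move=> h; apply: ae_eq0_cover E0_cover => n.
apply: (@limit_eq0 (E0 n) n.+1%:R) => //.
- apply: closed_measurable.
  have -> : E0 n = (fun x : R => `|x|) @^-1` `[n.+1%:R^-1, n.+1%:R].
    by apply/seteqP; split => x /=; rewrite in_itv.
  by apply: preimage_closed => [x _|]; [exact: norm_continuous|exact: itv_closed].
- by move=> x /andP[].
- exact: h.
Qed.

Lemma ae_eq0_of_growing :
  (forall M d : R, 0 < d -> exists t, [/\ - d < t < 0, t \in `[- T, 0[ & M < C_l t]) ->
  {ae mu, forall x, W x = 0}.
Proof.
have /andP[r0 r4] := hr; move=> big; apply: ae_eq0_of_E0 => n d e d0 e0.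
(* On [E0 n] this makes [|C_l t * x| > 2], beyond the support radius [1 + 2 * r] of [w]. *)
have [t [td tT Ct]] := big (2 * n.+1%:R) d d0.
exists t; split => // x /andP[x1 _]; rewrite /F.
rewrite (limit_far_eq0 hr hrho eps0 epsI A1 T0 app sigma_incr cv tT) ?mulr0 ?normr0 ?ltW//.
have [_ Cl0] := Cpos tT; rewrite normrM gtr0_norm//.
apply: (@lt_le_trans _ _ (2 * n.+1%:R * n.+1%:R^-1)).
  by rewrite mulfK ?pnatr_eq0//; lra.
by apply: ler_pM => //; rewrite ?invr_ge0 ?mulr_ge0// ltW.
Qed.

Lemma ae_eq0_of_vanishing (L : R) : 0 < L ->
  (forall e d : R, 0 < e -> 0 < d -> exists t,
     [/\ - d < t < 0, t \in `[- T, 0[, L <= C_l t & C_w t < e]) ->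
  {ae mu, forall x, W x = 0}.
Proof.
move=> L0 small; apply: ae_eq0_of_E0 => n d e d0 e0.
have Ln : 0 < L * n.+1%:R^-1 by rewrite mulr_gt0 ?invr_gt0.
have [B B0 hB] := limit_bounded_away hr hrho eps0 epsI A1 T0 app sigma_incr cv Ln.
(* On [E0 n] the point [C_l t * x] keeps distance [L / n.+1] from the origin, where [|w| <= B]. *)
have [t [td tT Lt Ct]] := small (e / B) d (divr_gt0 e0 B0) d0.
have [Cw0 Cl0] := Cpos tT.
exists t; split => // x /andP[x1 _]; rewrite /F normrM gtr0_norm//.
rewrite -[e](@divfK _ B) ?gt_eqF//; apply: ler_pM => //; [exact: ltW|exact: ltW|].
apply: hB => //; rewrite normrM gtr0_norm//.
by apply: ler_pM => //; rewrite ?invr_ge0 ?ler0n// ltW.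
Qed.

(** For nonzero [W] the three degenerate cases fail: [C_l >= L] at times arbitrarily near [0],
    [C_l <= L1] near [0], and [C_w >= kap] near [0] whenever [C_l >= L]. Then [no_H1_limit]
    applies. *)
Lemma limit_ae_trivial : {ae mu, forall x, W x = 0}.
Proof.
have /andP[r0 r4] := hr.
apply: contrapT => nW.
have [L [L0 freqL]] : exists L, 0 < L /\ forall d, 0 < d ->
    exists t, [/\ - d < t < 0, t \in `[- T, 0[ & L <= C_l t].
  apply: contrapT => H; apply: nW; apply: ae_eq0_of_shrinking => e e0.
  apply: contrapT => H1; apply: H; exists e; split => // d d0.
  apply: contrapT => H2; apply: H1; exists d => // t td tT.
  by rewrite ltNge; apply/negP => h; apply: H2; exists t.
have [L1 [d1 [d10 hL1]]] : exists L1 d1, 0 < d1 /\ forall t, - d1 < t < 0 ->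
    t \in `[- T, 0[ -> C_l t <= L1.
  apply: contrapT => H; apply: nW; apply: ae_eq0_of_growing => M d d0.
  apply: contrapT => H1; apply: H; exists M, d; split => // t td tT.
  by rewrite leNgt; apply/negP => h; apply: H1; exists t.
have [kap [d2 [kap0 d20 hkap]]] : exists kap d2, [/\ 0 < kap, 0 < d2 &
    forall t, - d2 < t < 0 -> t \in `[- T, 0[ -> L <= C_l t -> kap <= C_w t].
  apply: contrapT => H; apply: nW; apply: (ae_eq0_of_vanishing L0) => e d e0 d0.
  apply: contrapT => H1; apply: H; exists e, d; split => // t td tT Lt.
  by rewrite leNgt; apply/negP => h; apply: H1; exists t.
have kap20 : 0 < kap / 2 by rewrite divr_gt0.
apply: (no_H1_limit hr hrho wom mW mF FW WV (ltW eps0) epsJ kap20) => m0.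
(* The concentration factor is [C_l t / p] with [p <= r ^+ k], so this choice makes it at least
   [m0]. *)
have [k hk] : exists k, `|m0| * r ^+ k <= L.
  have : `|m0| * r ^+ k @[k --> \oo] --> `|m0| * 0.
    by apply: cvgMl_tmp; apply: cvg_expr; rewrite ger0_norm; lra.
  rewrite mulr0 => /cvgrPdist_le /(_ _ L0)[N _ hN].
  exists N; have := hN N (leqnn N); rewrite sub0r normrN.
  by apply: le_trans; exact: ler_norm.
have g0 : 0 <= growth k by exact: (growth_ge0 hr hrho A0).
set lo := r ^+ k * expR (growth k * - T).
have lo0 : 0 < lo by rewrite mulr_gt0 ?exprn_gt0 ?expR_gt0.
exists (L1 / lo) => d d0.
(* So close to time [0] the exponent [growth k * t] is above [- 2^-1], whence the height [X] is at
   least [2^-1]. *)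
have d30 : 0 < (2 * (growth k + 1))^-1 by rewrite invr_gt0 mulr_gt0//; lra.
have D0 : 0 < Num.min (Num.min d d1) (Num.min d2 (2 * (growth k + 1))^-1).
  by rewrite !lt_min d0 d10 d20.
have [t [/andP[td t0] tT Lt]] := freqL _ D0.
move: td; rewrite ltrNl !lt_min => /andP[/andP[td td1] /andP[td2 td3]].
have [Cw0 Cl0] := Cpos tT.
have [p [X [/andP[p1 p2] X1 hz]]] :=
  limit_near_bump hr hrho eps0 epsI A1 T0 app sigma_incr cv k tT.
have tT' : - T <= t by move: tT; rewrite in_itv/= => /andP[].
have lop : lo <= p.
  apply: le_trans p1; rewrite ler_pM2l ?exprn_gt0// ler_expR.
  exact: ler_wpM2l.
have p0 : 0 < p by exact: lt_le_trans lop.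
have X2 : 2^-1 <= X.
  apply: le_trans X1; apply: (@le_trans _ _ (expR (growth k * t))).
    apply: le_trans (expR_ge1Dx _).
    have : - t * (2 * (growth k + 1)) < 1.
      by rewrite -ltr_pdivlMr ?mul1r// mulr_gt0//; lra.
    by nra.
  by rewrite ler_peMl ?expR_ge0// exprn_ege1// ltW.
exists t, (C_l t / p), (C_w t * X); split => //.
- by rewrite t0 andbT; lra.
- apply/andP; split.
    rewrite ler_pdivlMr//; apply: le_trans Lt; apply: le_trans hk.
    apply: (@le_trans _ _ (`|m0| * p)); last by rewrite ler_wpM2l.
    by rewrite ler_wpM2r ?(ltW p0)// ler_norm.
  apply: ler_pM => //; [exact: ltW|by rewrite invr_ge0 ltW| |].
    by apply: hL1 => //; rewrite t0 andbT; lra.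
  by rewrite lef_pV2.
- apply: ler_pM => //; first exact: ltW.
  by apply: hkap => //; rewrite t0 andbT; lra.
- move=> x hx; have := hz (C_l t / p * x) hx.
  have -> : p * (C_l t / p * x) = C_l t * x by field; rewrite gt_eqF.
  rewrite -(ler_pM2l Cw0) => h.
  have -> : 3 * eps * (C_w t * X) = C_w t * (3 * eps * X) by ring.
  apply: le_trans h.
  have -> : F t x - C_w t * X * phi (C_l t / p * x) =
      C_w t * (w (C_l t * x) t - X * phi (C_l t / p * x)) by rewrite /F; ring.
  by rewrite normrM gtr0_norm.
Qed.

End not_self_similar.

(** * Choice of the parameters *)

Theorem theorem5 (R : realType) (r : R) (rho : R -> R)
    (hr : 0 < r <= 4^-1) (hrho : admissible_bump r rho) :
  exists2 eps0 : R, 0 < eps0 & forall eps : R, 0 < eps < eps0 ->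
  exists2 A0 : R, 1 < A0 & forall A : R, 1 < A < A0 ->
  forall a : R, 0 < a -> a = A * (1 - expR (- a)) ->
  let T := a / (1 - c_const r * eps) in
  forall w : R -> R -> R,
    constructed_solution r (odd_bump rho) eps A T w ->
    ~ asymptotically_self_similar T w.
Proof.
have /andP[r0 r4] := hr.
have I0 := odd_bump_div_integral_gt0 hr hrho.
have J0 := odd_bump_sq_integral_gt0 hr hrho.
set i := Rintegral _ _ _ in I0; set j := Rintegral _ _ _ in J0.
pose j1 := \int[lebesgue_measure]_x `|odd_bump rho x|.
have j10 : 0 <= j1 by exact: Rintegral_ge0.
have c0 : 0 <= c_const r.
  by rewrite divr_ge0 ?sqrtr_ge0// mulr_ge0 ?pi_ge0//; lra.
have e1 : 0 < i / 16 by rewrite divr_gt0.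
have e2 : 0 < j / (6 * (j1 + 1)) by rewrite divr_gt0// mulr_gt0//; lra.
have e3 : 0 < (c_const r + 1)^-1 by rewrite invr_gt0; lra.
(* The three entries give, in order, the moment bound [epsI], the pairing bound [epsJ], and
   [c_const r * eps < 1], hence [0 < T]. *)
exists (Num.min (i / 16) (Num.min (j / (6 * (j1 + 1))) (c_const r + 1)^-1)).
  by rewrite !lt_min e1 e2.
move=> eps /andP[eps0]; rewrite !lt_min => /and3P[h1 h2 h3].
(* The threshold [2] is an arbitrary number above [1]. *)
exists 2; first lra.
move=> A /andP[A1 _] a a0 _ T w [wn [un [wnk [xnk [sigma [app sg cv]]]]]].
have T0 : 0 < T.
  rewrite divr_gt0// subr_gt0.
  have : eps * (c_const r + 1) < 1 by rewrite -ltr_pdivlMr ?mul1r//; lra.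
  by nra.
have epsI : 16 * eps <= i by lra.
have epsJ : 3 * eps * j1 <= j / 2.
  have : eps * (6 * (j1 + 1)) < j by rewrite -ltr_pdivlMr// mulr_gt0//; lra.
  by nra.
case=> W [c_l [c_w [C_w [C_l [om [[_ prof] Cpos cC _ [wom FW]]]]]]].
have [om' [V [U [[_ [[mW _] _ WV]] nW _ _ _]]]] := prof.
apply: nW.
exact: (limit_ae_trivial hr hrho eps0 epsI epsJ A1 T0 app sg cv mW WV Cpos cC wom FW).
Qed.
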